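(* For each $\mathcal C\in\{\#\mathrm{para}_{W}\text{-}\mathrm{L},\ \#\mathrm{para}_{W[1]}\text{-}\mathrm{L},\ \#\mathrm{para}_{\beta}\text{-}\mathrm{L},\ \#\mathrm{para}_{\beta\text{-tail}}\text{-}\mathrm{L}\}$, the class $\mathcal C$ is closed under addition and multiplication: if $F_1,F_2\in\mathcal C$, then the functions $(x,k)\mapsto F_1(x,k)+F_2(x,k)$ and $(x,k)\mapsto F_1(x,k)\cdot F_2(x,k)$ are in $\mathcal C$.
   Context: Inputs are pairs $(x,k)$, $x\in\{0,1\}^*$, parameter $k\in\mathbb N$; parameterised functions are $F:\{0,1\}^*\times\mathbb N\to\mathbb N$. Machines are TMs with random access to the input (a logarithmic-size index tape allows reading any input bit in one step). A nondeterministic TM is a deterministic TM with an extra read-only choice tape (not counted for space); a nondeterministic step is a step in which the choice-tape head moves to a cell not visited before; $\#\mathrm{acc}_M(x,k)$ is the number of accepting computation paths of $M$ on $(x,k)$. A $\mathrm{para}\text{-}\mathrm{L}$-machine uses space $O(\log|x|+f(k))$ for a computable $f$. A nondeterministic machine is $k$-bounded if for a computable $f$ it reads at most $f(k)\cdot\log|x|$ choice-tape bits on every input $(x,k)$; it has read-once access if its choice-tape head moves only one way; it is tail-nondeterministic if for a computable $g$ it makes at most $g(k)\cdot\log|x|$ steps after its first nondeterministic step on every input $(x,k)$. $F\in\#\mathrm{para}_{W}\text{-}\mathrm{L}$ iff there is a $k$-bounded nondeterministic $\mathrm{para}\text{-}\mathrm{L}$-machine $M$ with $\#\mathrm{acc}_M(x,k)=F(x,k)$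 for all $(x,k)$; $\#\mathrm{para}_{\beta}\text{-}\mathrm{L}$ additionally requires read-once access, $\#\mathrm{para}_{W[1]}\text{-}\mathrm{L}$ additionally requires tail-nondeterminism, and $\#\mathrm{para}_{\beta\text{-tail}}\text{-}\mathrm{L}$ requires both. *)

(* Defs.v *)
From mathcomp Require Import all_boot.
Set Implicit Arguments. Unset Strict Implicit. Unset Printing Implicit Defensive.

Inductive dir := DL | DS | DR.

Definition mv (d : dir) (p : nat) : nat :=
  match d with DL => p.-1 | DS => p | DR => p.+1 end.

Definition lg (n : nat) : nat := (trunc_log 2 n).+1.

Record tm := TM {
  tQ : finType;
  tG : finType;
  tblank : tG;
  tone : tG;
  tq0 : tQ;
  thalt : pred tQ;
  tdelta : tQ -> tG -> tQ * tG * dir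
}.

Record tconf (T : tm) := TConf { tcq : tQ T; tctape : nat -> tG T; tch : nat }.

Definition tstep (T : tm) (c : tconf T) : tconf T :=
  if thalt (tcq c) then c else
  let: (q', a, d) := tdelta (tcq c) (tctape c (tch c)) in
  TConf q' (fun i => if i == tch c then a else tctape c i) (mv d (tch c)).

Definition tinit (T : tm) (k : nat) : tconf T :=
  TConf (tq0 T) (fun i => if i < k then tone T else tblank T) 0.

Definition computes (T : tm) (f : nat -> nat) : Prop :=
  tone T != tblank T /\
  forall k, exists n,
    let c := iter n (@tstep T) (tinit T k) in
    thalt (tcq c) /\
    forall i, tctape c i = (if i < f k then tone T else tblank T).

Definition computable (f : nat -> nat) : Prop := exists T : tm, computes T f.

(* Input tape symbols.  The input (x,k) is laid out as
   x_0 ... x_{|x|-1}  #  1^k  and blanks afterwards. *)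
Inductive isym := IBit of bool | ISep | IBlank.

Definition inp (x : seq bool) (k : nat) (i : nat) : isym :=
  if i < size x then IBit (nth false x i)
  else if i == size x then ISep
  else if i <= size x + k then IBit true
  else IBlank.

(* A machine: finite control, one work tape over a finite alphabet, an
   index tape (binary, its contents as a number gives the input position
   read in one step), and a read-only choice tape.  The choice tape has a
   left-end marker (read as None) in cell 0 and choice bits in cells 1,2,... *)
Record machine := Machine {
  mQ : finType;
  mG : finType;
  mblank : mG;
  mq0 : mQ;
  mhalt : pred mQ;
  macc : pred mQ;
  mdelta : mQ -> isym -> mG -> bool -> option bool ->
           mQ * mG * dir * bool * dir * dir
    (* new state, work symbol written, work head move,
       index bit written, index head move, choice head move *)
}.

Record config (M : machine) := Config {
  cq : mQ M;
  cwork : nat -> mG M;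
  cwh : nat;
  cidx : nat;   (* index tape contents, cell i = i-th binary digit *)
  cih : nat;
  cch : nat
}.

Definition getbit (n h : nat) : bool := odd (n %/ 2 ^ h).
Definition setbit (n h : nat) (b : bool) : nat :=
  n - getbit n h * 2 ^ h + b * 2 ^ h.

Definition chread (c : nat -> bool) (p : nat) : option bool :=
  if p is p'.+1 then Some (c p') else None.

Definition step (M : machine) (x : seq bool) (k : nat) (c : nat -> bool)
  (cf : config M) : config M :=
  if mhalt (cq cf) then cf else
  let: (q', a, dw, b, di, dc) :=
     mdelta (cq cf) (inp x k (cidx cf)) (cwork cf (cwh cf))
            (getbit (cidx cf) (cih cf)) (chread c (cch cf)) in
  Config q' (fun i => if i == cwh cf then a else cwork cf i) (mv dw (cwh cf))
         (setbit (cidx cf) (cih cf) b) (mv di (cih cf)) (mv dc (cch cf)).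

Definition init (M : machine) : config M :=
  Config (mq0 M) (fun _ => mblank M) 0 0 0 0.

Definition run (M : machine) (x : seq bool) (k : nat) (c : nat -> bool) (n : nat)
  : config M := iter n (@step M x k c) (@init M).
Arguments run M x k c n : clear implicits.

Definition accepting (M : machine) (cf : config M) : bool :=
  mhalt (cq cf) && macc (cq cf).

(* w is (the sequence of choice bits of) an accepting computation path:
   the machine reads exactly the choice cells 1..|w|, holding w, and halts
   accepting. *)
Definition acc_path (M : machine) (x : seq bool) (k : nat) (w : seq bool) : Prop :=
  let c := fun i => nth false w i in
  exists n, accepting (run M x k c n) /\
    (forall m, m <= n -> cch (run M x k c m) <= size w) /\
    (exists m, m <= n /\ cch (run M x k c m) = size w).

Definition num_acc (M : machine) (x : seq bool) (k : nat) (N : nat) : Prop :=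
  exists s : seq (seq bool),
    uniq s /\ (forall w, w \in s <-> acc_path M x k w) /\ size s = N.

Definition para_L_space (M : machine) (cs : nat) (f : nat -> nat) : Prop :=
  forall x k c n, let cf := run M x k c n in
    cwh cf <= cs * (lg (size x) + f k) /\ cih cf <= cs * (lg (size x) + f k).

Definition k_bounded (M : machine) (f : nat -> nat) : Prop :=
  forall x k c n, cch (run M x k c n) <= f k * lg (size x).

Definition read_once (M : machine) : Prop :=
  forall x k c n, cch (run M x k c n) <= cch (run M x k c n.+1).

(* tail-nondeterministic: at most g(k) * log|x| steps after the first
   nondeterministic step (the first move of the choice head to cell 1) *)
Definition tail_nondet (M : machine) (g : nat -> nat) : Prop :=
  forall x k c n, 0 < cch (run M x k c n) ->
    mhalt (cq (run M x k c (n + g k * lg (size x)))).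

Definition pfun := seq bool -> nat -> nat.

Definition base_para (M : machine) (F : pfun) : Prop :=
  (exists cs f, computable f /\ para_L_space M cs f) /\
  (exists f, computable f /\ k_bounded M f) /\
  (forall x k, num_acc M x k (F x k)).

Definition sharp_paraW_L (F : pfun) : Prop :=
  exists M, base_para M F.

Definition sharp_paraW1_L (F : pfun) : Prop :=
  exists M, base_para M F /\ exists g, computable g /\ tail_nondet M g.

Definition sharp_paraBeta_L (F : pfun) : Prop :=
  exists M, base_para M F /\ read_once M.

Definition sharp_paraBetaTail_L (F : pfun) : Prop :=
  exists M, base_para M F /\ read_once M /\
    exists g, computable g /\ tail_nondet M g.

Inductive para_class := CW | CW1 | CBeta | CBetaTail.

Definition in_class (C : para_class) : pfun -> Prop :=
  match C with
  | CW => sharp_paraW_L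
  | CW1 => sharp_paraW1_L
  | CBeta => sharp_paraBeta_L
  | CBetaTail => sharp_paraBetaTail_L
  end.

(* Main.v *)
Require Import Defs.
From mathcomp Require Import all_boot.
From mathcomp Require Import zify.
From HB Require Import structures.
From Stdlib Require Import FunctionalExtensionality Classical.
Set Implicit Arguments. Unset Strict Implicit. Unset Printing Implicit Defensive.

(* A single machine, with a flag selecting sum or product, serves all four classes.
   While its choice head stays on cell 0 it simulates the deterministic parts of both
   machines one after the other, keeping their configurations on two tracks of the work
   tape and stopping each of them just before its first nondeterministic step. Such a
   part may loop, which must not prevent the other machine from contributing to a sum;
   a counter with one digit per work cell in use, in a base larger than the number of
   contents of a cell, overflows exactly in that case (pigeonhole). In the tail, a saved
   configuration is reloaded, in time linear in the space, and then continued directly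
   with a constant number of steps per simulated step: hence tail-nondeterminism and
   read-once access are preserved.
   With two-way access, a simulated machine must recognize the left end of its part of
   the choice tape, and the path must end exactly where the machine stops reading. So
   every simulated choice cell is a block of three bits, a flag for the origin, a flag
   for the last cell used, and the choice bit, and the computation is rejected unless the
   flags tell the truth. These blocks form a prefix code, which makes the accepting paths
   correspond to pairs, or to tagged single paths, of the given machines. *)

(** * Computable bounds *)

(** The machine cannot compute its space bound, so the region used on the work tape is not reserved
    in advance: it grows with the simulated heads, and the loop counter grows with it. Once the
    choice head has left cell 0, a tail has too few steps left to run a deterministic part, which is
    why both are carried out beforehand and their last configurations kept. Nor is there time to
    maintain marks on the tracks: in the tail the simulated heads and index become the real ones. In
    a product, the first tail therefore leaves the index tape in an unknown state, possibly with
    bits outside the region and with its head anywhere on a tape without end mark; the states [G0]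
    to [Z] repair this in linear time. An accepting path consists of exactly the cells read, so a
    machine that halts in the middle of its blocks must still walk to the last one, where the path
    ends or the other machine takes over. Computability means having a concrete Turing machine, so
    combined bounds need an explicit construction; one for $f+g+1$ is enough, because all bounds in
    the definitions are upper bounds. *)

Section Reach.
Variables (T : Type) (f : T -> T) (ok : T -> Prop).

(** The endpoint is exempt from [ok], so traces concatenate without a condition at the joint; the
    last configuration is only known to be one step away from an [ok] one. *)
Definition reach n a b := iter n f a = b /\ forall m, m < n -> ok (iter m f a).

Lemma reach0 a : reach 0 a a.
Proof. by []. Qed.

Lemma reach_trans m n a b c : reach m a b -> reach n b c -> reach (m + n) a c.
Proof.
move=> [<- okm] [<- okn]; split=> [|i lti]; first by rewrite addnC iterD.
case: (ltnP i m) => [/okm //|lemi].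
by rewrite -(subnK lemi) iterD; apply: okn; lia.
Qed.

Lemma reachS n a b : ok a -> reach n (f a) b -> reach n.+1 a b.
Proof.
move=> oka; rewrite -add1n; apply: reach_trans; split=> // m.
by rewrite ltnS leqn0 => /eqP->.
Qed.

Lemma reach1 a b : ok a -> f a = b -> reach 1 a b.
Proof. by move=> oka <-; apply: reachS => //; apply: reach0. Qed.

End Reach.

Lemma reach_weak (T : Type) (f : T -> T) (ok ok' : T -> Prop) n a b :
  (forall y, ok y -> ok' y) -> reach f ok n a b -> reach f ok' n a b.
Proof. by move=> imp [e h]; split=> // m /h /imp. Qed.

(** * A Turing machine for the successor of a sum of unary functions *)

Section SumTM.
Variables T1 T2 : tm.

Definition sumG : finType := (tG T1 * tG T2 * bool)%type.
Definition sumQ : finType := (tQ T1 + tQ T2 + 'I_9)%type.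
Definition sum_ctl i (lti : i < 9) : sumQ := inr (Ordinal lti).
Notation stg i := (@sum_ctl i isT).

(** The symbol [tone] is a pair, so the unary input lies on both tracks from the start. Stage 0
    flags the origin; stages 2 to 5 move the ones of the second track, one at a time, to the end of
    the block on the first; stages 6 and 7 turn the result into ones of the sum machine. The extra
    one written on leaving stage 3 makes cell 0 part of the block swept by stage 7, so its flag is
    erased even if both values are 0. *)
Definition sum_delta (q : sumQ) (a : sumG) : sumQ * sumG * dir :=
  let: (a1, a2, fl) := a in
  match q with
  | inl (inl q) =>
      if thalt q then (stg 1, a, DS)
      else let: (q', a', d) := tdelta q a1 in (inl (inl q'), (a', a2, fl), d)
  | inl (inr q) =>
      if thalt q then (stg 2, a, DS)
      else let: (q', a', d) := tdelta q a2 in (inl (inr q'), (a1, a', fl), d)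
  | inr t =>
      match val t with
      | 0 => (inl (inl (tq0 T1)), (a1, a2, true), DS)
      | 1 => if fl then (inl (inr (tq0 T2)), a, DS) else (stg 1, a, DL)
      | 2 => if fl then (stg 3, a, DS) else (stg 2, a, DL)
      | 3 => if a2 == tone T2 then (stg 4, (a1, tblank T2, fl), DS)
             else if a1 == tone T1 then (stg 3, a, DR)
             else (stg 6, (tone T1, a2, fl), DS)
      | 4 => if fl then (stg 5, a, DS) else (stg 4, a, DL)
      | 5 => if a1 == tone T1 then (stg 5, a, DR)
             else (stg 2, (tone T1, a2, fl), DS)
      | 6 => if fl then (stg 7, a, DS) else (stg 6, a, DL)
      | 7 => if a1 == tone T1 then (stg 7, (tone T1, tone T2, false), DR)
             else (stg 8, a, DS)
      | _ => (stg 8, a, DS)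
      end
  end.

Definition sum_tm : tm :=
  @TM sumQ sumG (tblank T1, tblank T2, false) (tone T1, tone T2, false)
      (stg 0) (fun q => q == stg 8) sum_delta.

Definition sum_tape (t1 : nat -> tG T1) (t2 : nat -> tG T2) (i : nat) : sumG :=
  (t1 i, t2 i, i == 0).

Local Notation ok := (fun _ => True).
Local Notation goes a b := (exists n, reach (@tstep sum_tm) ok n a b).
Local Notation conf := (@TConf sum_tm).

Lemma sum_goes_trans a b c : goes a b -> goes b c -> goes a c.
Proof. by move=> [m ab] [n bc]; exists (m + n); apply: reach_trans ab bc. Qed.

Lemma goes1 a b : tstep a = b -> goes a b.
Proof. by move=> e; exists 1; apply: reach1. Qed.

Lemma sum_goes_local (q q' : sumQ) h (t t' : nat -> sumG) d :
  q != stg 8 -> sum_delta q (t h) = (q', t' h, d) ->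
  (forall i, i != h -> t' i = t i) ->
  goes (conf q t h) (conf q' t' (mv d h)).
Proof.
move=> q8 H1 H2; apply: goes1; rewrite /tstep [thalt _](negbTE q8).
rewrite [tdelta _ _]H1; congr TConf.
by apply: functional_extensionality => i /=; case: eqP => [->|/eqP/H2].
Qed.

Lemma sum_goes_rewind t1 t2 (q q' : sumQ) h :
  q != stg 8 ->
  (forall a1 a2 fl, sum_delta q (a1, a2, fl) =
     if fl then (q', (a1, a2, fl), DS) else (q, (a1, a2, fl), DL)) ->
  goes (conf q (sum_tape t1 t2) h) (conf q' (sum_tape t1 t2) 0).
Proof.
move=> q8 dq; elim: h => [|h IH]; first by apply: (@sum_goes_local _ _ _ _ _ DS) => //; exact: dq.
by apply: sum_goes_trans IH; apply: (@sum_goes_local _ _ _ _ _ DL) => //; exact: dq.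
Qed.

Lemma sum_goes_track1 c t2 :
  ~~ thalt (tcq c) ->
  let c' := @tstep T1 c in
  goes (conf (inl (inl (tcq c))) (sum_tape (tctape c) t2) (tch c))
       (conf (inl (inl (tcq c'))) (sum_tape (tctape c') t2) (tch c')).
Proof.
move=> nh; apply: goes1; rewrite /tstep /= (negbTE nh).
case: tdelta => [[q' a] d] /=; congr TConf.
by apply: functional_extensionality => i; rewrite /sum_tape; case: eqP => // ->.
Qed.

Lemma sum_goes_track2 t1 c :
  ~~ thalt (tcq c) ->
  let c' := @tstep T2 c in
  goes (conf (inl (inr (tcq c))) (sum_tape t1 (tctape c)) (tch c))
       (conf (inl (inr (tcq c'))) (sum_tape t1 (tctape c')) (tch c')).
Proof.
move=> nh; apply: goes1; rewrite /tstep /= (negbTE nh).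
case: tdelta => [[q' a] d] /=; congr TConf.
by apply: functional_extensionality => i; rewrite /sum_tape; case: eqP => // ->.
Qed.

Lemma sum_goes_run1 c t2 n : exists h,
  let c' := iter n (@tstep T1) c in
  thalt (tcq c') ->
  goes (conf (inl (inl (tcq c))) (sum_tape (tctape c) t2) (tch c))
       (conf (stg 1) (sum_tape (tctape c') t2) h).
Proof.
elim: n c => [|n IH] c.
  exists (tch c) => /= hc; apply: goes1; rewrite /tstep /= hc /=; congr TConf.
  by apply: functional_extensionality => i; case: eqP => // ->.
have [hc|nhc] := boolP (thalt (tcq c)).
  have [h H] := IH c; exists h; rewrite iterSr; suff -> : tstep c = c by [].
  by rewrite /tstep hc.
have [h H] := IH (tstep c); exists h; rewrite iterSr => /= hc'.
exact: sum_goes_trans (sum_goes_track1 _ nhc) (H hc').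
Qed.

Lemma sum_goes_run2 t1 c n : exists h,
  let c' := iter n (@tstep T2) c in
  thalt (tcq c') ->
  goes (conf (inl (inr (tcq c))) (sum_tape t1 (tctape c)) (tch c))
       (conf (stg 2) (sum_tape t1 (tctape c')) h).
Proof.
elim: n c => [|n IH] c.
  exists (tch c) => /= hc; apply: goes1; rewrite /tstep /= hc /=; congr TConf.
  by apply: functional_extensionality => i; case: eqP => // ->.
have [hc|nhc] := boolP (thalt (tcq c)).
  have [h H] := IH c; exists h; rewrite iterSr; suff -> : tstep c = c by [].
  by rewrite /tstep hc.
have [h H] := IH (tstep c); exists h; rewrite iterSr => /= hc'.
exact: sum_goes_trans (sum_goes_track2 _ nhc) (H hc').
Qed.


Lemma sum_goes_sweep (q : sumQ) h e (t t' : nat -> sumG) :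
  h <= e -> q != stg 8 ->
  (forall i, h <= i < e -> sum_delta q (t i) = (q, t' i, DR)) ->
  (forall i, ~~ (h <= i < e) -> t' i = t i) ->
  goes (conf q t h) (conf q t' e).
Proof.
move=> le_he q8; rewrite -(subnKC le_he); move: (e - h) => d {le_he}.
elim: d h t => [|d IH] h t H1 H2.
  rewrite addn0 (_ : t' = t); first by exists 0; apply: reach0.
  by apply: functional_extensionality => i; rewrite H2 // addn0; lia.
rewrite -addSnnS; pose t1 i := if i == h then t' h else t i.
apply: (@sum_goes_trans _ (conf q t1 h.+1)); last first.
  apply: IH => i hi; rewrite /t1; case: eqP => ih.
  - by lia.
  - by apply: H1; lia.
  - by rewrite ih.
  - by apply: H2; lia.
by apply: (@sum_goes_local _ _ _ _ _ DR) => //= [|i /negbTE ne]; rewrite /t1 ?ne // eqxx; apply: H1; lia.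
Qed.

Hypotheses (o1 : tone T1 != tblank T1) (o2 : tone T2 != tblank T2).

Let blank1 : (tblank T1 == tone T1) = false. Proof. by rewrite eq_sym (negbTE o1). Qed.
Let blank2 : (tblank T2 == tone T2) = false. Proof. by rewrite eq_sym (negbTE o2). Qed.

(* [m] ones on the first track, and the ones of cells [r], ..., [n - 1] on the second. *)
Let tape m r n := sum_tape (fun i => if i < m then tone T1 else tblank T1)
  (fun i => if r <= i < n then tone T2 else tblank T2).

(** The scan of stage 3 gets across the erased cells because they hold ones of the first track; this
    is what [r <= m] is for, and it persists since both numbers grow by one. *)
Lemma sum_goes_move m r n : r < n -> r <= m ->
  goes (conf (stg 3) (tape m r n) 0) (conf (stg 3) (tape m.+1 r.+1 n) 0).
Proof.
move=> rn rm.
apply: (@sum_goes_trans _ (conf (stg 3) (tape m r n) r)).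
  apply: sum_goes_sweep => // i hi; rewrite /tape /sum_tape.
  have -> : i < m by lia.
  have -> : (r <= i < n) = false by lia.
  by rewrite /= blank2 eqxx.
apply: (@sum_goes_trans _ (conf (stg 4) (tape m r.+1 n) r)).
  apply: (@sum_goes_local _ _ _ _ _ DS) => // [|i hi]; rewrite /tape /sum_tape.
    by rewrite leqnn rn ltnn /= eqxx.
  by congr (_, _, _); congr (if _ then _ else _); lia.
apply: sum_goes_trans.
  by apply: (@sum_goes_rewind _ _ (stg 4) (stg 5)) => // a1 a2 [].
apply: (@sum_goes_trans _ (conf (stg 5) (tape m r.+1 n) m)).
  apply: sum_goes_sweep => // i hi; rewrite /tape /sum_tape.
  have -> : i < m by lia.
  by rewrite /= eqxx.
apply: (@sum_goes_trans _ (conf (stg 2) (tape m.+1 r.+1 n) m)).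
  apply: (@sum_goes_local _ _ _ _ _ DS) => // [|i hi]; rewrite /tape /sum_tape.
    by rewrite ltnn ltnSn /= blank1.
  by congr (_, _, _); congr (if _ then _ else _); lia.
by apply: (@sum_goes_rewind _ _ (stg 2) (stg 3)) => // a1 a2 [].
Qed.

Lemma sum_goes_merge m r n : r <= n -> r <= m ->
  goes (conf (stg 3) (tape m r n) 0) (conf (stg 3) (tape (m + (n - r)) n n) 0).
Proof.
move=> rn; rewrite -{1 3 4}(subnKC rn).
move: (n - r) => d {rn}; elim: d m r => [|d IH] m r rm.
  by rewrite !addn0; exists 0; apply: reach0.
rewrite -addSnnS -addSnnS; apply: sum_goes_trans (IH _ _ _); last by lia.
by apply: sum_goes_move; lia.
Qed.

Lemma sum_goes_finish m n :
  goes (conf (stg 3) (tape m n n) 0)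
    (conf (stg 8) (fun i => if i < m.+1 then tone sum_tm else tblank sum_tm) m.+1).
Proof.
have nr i : (n <= i < n) = false by lia.
apply: (@sum_goes_trans _ (conf (stg 3) (tape m n n) m)).
  apply: sum_goes_sweep => // i hi; rewrite /tape /sum_tape nr.
  have -> : i < m by lia.
  by rewrite /= blank2 eqxx.
apply: (@sum_goes_trans _ (conf (stg 6) (tape m.+1 n n) m)).
  apply: (@sum_goes_local _ _ _ _ _ DS) => // [|i hi]; rewrite /tape /sum_tape.
    by rewrite nr ltnn ltnSn /= blank2 blank1.
  by congr (_, _, _); congr (if _ then _ else _); lia.
apply: sum_goes_trans.
  by apply: (@sum_goes_rewind _ _ (stg 6) (stg 7)) => // a1 a2 [].
pose t i := if i < m.+1 then tone sum_tm else tblank sum_tm.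
rewrite -/t.
apply: (@sum_goes_trans _ (conf (stg 7) t m.+1)).
  apply: sum_goes_sweep => // i hi; rewrite /tape /sum_tape /t nr.
    have -> : i < m.+1 by lia.
    by rewrite /= eqxx.
  have -> : (i < m.+1) = false by lia.
  by have -> : (i == 0) = false by lia.
apply: (@sum_goes_local _ _ _ _ _ DS) => //=.
by rewrite /t ltnn /= blank1.
Qed.

End SumTM.

Lemma computable_addS f g :
  computable f -> computable g -> computable (fun k => (f k + g k).+1).
Proof.
move=> [T1 [o1 c1]] [T2 [o2 c2]]; exists (sum_tm T1 T2); split=> [|k].
  by rewrite /= !xpair_eqE (negbTE o1).
have [n1 [h1 e1]] := c1 k; have [n2 [h2 e2]] := c2 k.
set b := tinit _ k.
suff [n [e _]] : exists n, reach (@tstep (sum_tm T1 T2)) (fun=> True) n b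
    (@TConf (sum_tm T1 T2) (@sum_ctl T1 T2 8 isT)
    (fun i => if i < (f k + g k).+1 then tone (sum_tm T1 T2) else tblank _) (f k + g k).+1).
  by exists n; rewrite e.
have [p1 H1] := sum_goes_run1 (tinit T1 k) (tctape (tinit T2 k)) n1.
have [p2 H2] := sum_goes_run2 (tctape (iter n1 (@tstep T1) (tinit T1 k))) (tinit T2 k) n2.
have := sum_goes_merge o1 o2 (leq0n (g k)) (leq0n (f k)); rewrite subn0.
rewrite -[fun i => if i < f k then _ else _](functional_extensionality _ _ e1).
rewrite -[fun i => if 0 <= i < g k then _ else _](functional_extensionality _ _ e2).
move=> merge; apply: (sum_goes_trans _ (sum_goes_finish o1 o2 _ (g k))).
apply: (sum_goes_trans _ merge).
apply: sum_goes_trans; last by apply: (@sum_goes_rewind _ _ _ _ (@sum_ctl T1 T2 2 isT) _ p2) => // a1 a2 [].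
apply: (sum_goes_trans _ (H2 h2)).
apply: sum_goes_trans; last by apply: (@sum_goes_rewind _ _ _ _ (@sum_ctl T1 T2 1 isT) _ p1) => // a1 a2 [].
apply: (sum_goes_trans _ (H1 h1)).
apply: (@sum_goes_local _ _ (@sum_ctl T1 T2 0 isT) _ _ _ _ DS) => //= [|i /negbTE i0].
  by rewrite /sum_tape /=; case: ifP.
by rewrite /sum_tape i0 /=; case: ifP.
Qed.

Lemma computable_id : computable id.
Proof.
exists (@TM bool bool false true true (fun=> true) (fun q a => (q, a, DS))).
by split=> // k; exists 0.
Qed.

Definition dominated (f : nat -> nat) := exists2 h, computable h & forall k, f k <= h k.

Lemma dominated_le f g : (forall k, f k <= g k) -> dominated g -> dominated f.
Proof. by move=> fg [h ch gh]; exists h => // k; apply: leq_trans (gh k). Qed.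

Lemma dominated_computable f : computable f -> dominated f.
Proof. by exists f. Qed.

Lemma dominated_add f g : dominated f -> dominated g -> dominated (fun k => f k + g k).
Proof.
move=> [f' cf ff] [g' cg gg]; exists (fun k => (f' k + g' k).+1).
  exact: computable_addS.
by move=> k; apply: leqW; apply: leq_add.
Qed.

Lemma dominated_mul c f : dominated f -> dominated (fun k => c * f k).
Proof.
move=> df; elim: c => [|c IH]; last exact: dominated_add.
by apply: dominated_le df => k; rewrite mul0n.
Qed.

Lemma dominated_const c : dominated (fun=> c).
Proof.
have d1 : dominated (fun=> 1).
  exists (fun k => (k + k).+1) => //; exact: computable_addS computable_id computable_id.
by apply: dominated_le (dominated_mul c d1) => k; rewrite muln1.
Qed.

(** * The combined machine *)

Lemma getbitS n i : getbit n i.+1 = getbit n./2 i.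
Proof. by rewrite /getbit expnS divnMA divn2. Qed.

Lemma getbit0n i : getbit 0 i = false.
Proof. by rewrite /getbit div0n. Qed.

Lemma getbit_inj m n : getbit m =1 getbit n -> m = n.
Proof.
have [N] := ubnP (m + n); elim: N m n => // N IH m n mnN e.
have := e 0; rewrite /getbit !divn1 => o.
have [mn0|mn0] := posnP (m + n); first by lia.
rewrite -(odd_double_half m) -(odd_double_half n) o; congr (_ + _.*2).
by apply: IH => [|i]; [lia | rewrite -!getbitS].
Qed.

Lemma getbit_small n i s : n < 2 ^ s -> s <= i -> getbit n i = false.
Proof.
move=> lt_n le_si; rewrite /getbit divn_small //.
by apply: leq_trans lt_n _; rewrite leq_exp2l.
Qed.

Lemma ltn_getbit n s : (forall i, s <= i -> getbit n i = false) -> n < 2 ^ s.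
Proof.
elim: s n => [|s IH] n H.
  by rewrite (@getbit_inj n 0) // => i; rewrite H // getbit0n.
have : n./2 < 2 ^ s by apply: IH => i si; rewrite -getbitS H.
by rewrite expnS; lia.
Qed.

Lemma setbitS n h b : setbit n h.+1 b = odd n + (setbit n./2 h b).*2.
Proof.
rewrite /setbit getbitS.
have le_bit : getbit n./2 h * 2 ^ h <= n./2.
  have := leq_trunc_div n./2 (2 ^ h); rewrite /getbit; apply: leq_trans.
  by rewrite leq_mul2r; apply/orP; right; case: (_ %/ _) => // d; case: odd.
rewrite !expnS !(mulnCA _ 2) /setbit -{1}(odd_double_half n); move: (n./2) le_bit => m.
move: (getbit m h * 2 ^ h) => y; move: (2 ^ h) => p le_y.
by case: b; lia.
Qed.

Lemma getbit_setbit n h b i : getbit (setbit n h b) i = if i == h then b else getbit n i.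
Proof.
elim: h n i => [|h IH] n i.
  rewrite /setbit /getbit !divn1 !muln1.
  case: i => [|i] /=; first by rewrite divn1; lia.
  by rewrite -!/(getbit _ _) !getbitS; congr getbit; lia.
rewrite setbitS; case: i => [|i]; first by rewrite /getbit !divn1 oddD odd_double addbF oddb.
by rewrite getbitS (getbitS n) eqSS -IH half_bit_double.
Qed.

Lemma setbit_getbit n h : setbit n h (getbit n h) = n.
Proof. by apply: getbit_inj => i; rewrite getbit_setbit; case: eqP => // ->. Qed.

Lemma setbit_ltn n h b s : n < 2 ^ s -> h < s -> setbit n h b < 2 ^ s.
Proof.
move=> ns hs; apply: ltn_getbit => i si; rewrite getbit_setbit ifN; last by lia.
exact: getbit_small ns si.
Qed.

(* The index tape after its cells [0], ..., [i - 1] have been overwritten by bits of [v]. *)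
Fixpoint putbits (v : nat -> bool) idx i :=
  if i is i'.+1 then setbit (putbits v idx i') i' (v i') else idx.

Lemma getbit_putbits v idx i m :
  getbit (putbits v idx i) m = if m < i then v m else getbit idx m.
Proof.
elim: i => //= i IH; rewrite getbit_setbit IH ltnS.
by rewrite [in RHS]leq_eqVlt; case: eqP => [->|_].

Qed.

Lemma putbits_all v idx s : idx < 2 ^ s -> v < 2 ^ s -> putbits (getbit v) idx s = v.
Proof.
move=> ls vs; apply: getbit_inj => i; rewrite getbit_putbits; case: ltnP => // si.
by rewrite (getbit_small ls) // (getbit_small vs).
Qed.

Definition dir_code d := match d with DL => Some false | DS => None | DR => Some true end.
Definition dir_decode o := match o with Some true => DR | Some false => DL | None => DS end.
Lemma dir_codeK : cancel dir_code dir_decode. Proof. by case. Qed.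
HB.instance Definition _ := Finite.copy dir (can_type dir_codeK).

Section Machine.
Variable M : bool -> machine.
Variable isprod : bool.
Notation Q j := (mQ (M j)).
Notation G j := (mG (M j)).

Definition content j : finType := (G j * bool * bool * bool)%type.
(** The factor [#|Q j|] pays for the control state: with [s > 0] cells there are at most
    [#|Q j| * #|content j| ^ s <= lim j ^ s] configurations, fewer than the [(lim j).+1 ^ s] values
    of the counter. *)
Definition lim j := #|Q j| * #|content j|.

(* Work symbol, work head mark, index bit, index head mark, counter digit. *)
Definition track j : finType := (content j * 'I_(lim j).+1)%type.

(* The two booleans mark the left end of the work tape and its visited region. *)
Definition cell : finType := (track true * track false * bool * bool)%type.

Definition get j (p : track true * track false) : track j :=
  if j is true then p.1 else p.2.
Definition put j (p : track true * track false) : track j -> track true * track false :=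
  if j is true then fun v => (v, p.2) else fun v => (p.1, v).

Definition outcomes : finType := (option (Q true) * option (Q false))%type.
Definition outcome j (oc : outcomes) : option (Q j) := if j is true then oc.1 else oc.2.
Definition set_outcome j (oc : outcomes) : option (Q j) -> outcomes :=
  if j is true then fun v => (v, oc.2) else fun v => (oc.1, v).

(* [Init0], [InitA], [InitB] mark a region whose length [s] satisfies [|x| + k < 2 ^ s];
   [Copy] to [Count] carry out one simulated deterministic step; [Reload], [Pidx], [Pwork]
   restore a saved configuration, which [Rd0] to [Back] continue; [G0] to [Z] clear the
   index tape. The direction stored in [Rd0], [Rd1], [Rd2] is that of the last move on the
   virtual choice tape, [DS] meaning that its origin is being read. *)
Inductive ctl :=
| Init0 | InitA | InitB
| Copy j of Q j & G j & bool
| Wfind j of Q j & G j & dir & bool & dir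
| Wmark j of Q j & bool & dir
| Ifind j of Q j & bool & dir
| Imark j of Q j
| Count j of Q j
| Tail | Pick
| Reload (j : bool) | Pidx (j : bool) | Pwork (j : bool)
| Rd0 j of Q j & bool & dir
| Rd1 j of Q j & bool & dir & bool
| Rd2 j of Q j & bool & dir & bool & bool
| Live j of Q j & bool & bool & bool & bool
| Back j of Q j & bool & bool & bool
| G0 | G1 | Ga | Gb | Gc | Z | Acc | Rej.

(** Finiteness is transferred along an injection into a product: a tag, a dependent pair because
    states and symbols vary with [j], and directions and booleans that get fixed values where a
    control state has no such argument. *)
Definition ctl_codeT : finType :=
  ('I_27 * {j : bool & (Q j * G j)%type} * dir * dir * bool * bool * bool * bool)%type.

Definition ctl_code (c : ctl) : ctl_codeT :=
  let tg n (h : n < 27) := Ordinal h in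
  let ex j (q : Q j) (g : G j) := existT (fun j => (Q j * G j)%type) j (q, g) in
  let ex0 j := ex j (mq0 _) (mblank _) in
  let mk0 n (h : n < 27) := (Ordinal h, ex0 true, DS, DS, true, true, true, true) in
  match c with
  | Init0 => mk0 0 isT | InitA => mk0 1 isT | InitB => mk0 2 isT
  | Copy j q g b => (tg 3 isT, ex j q g, DS, DS, b, true, true, true)
  | Wfind j q g d b d' => (tg 4 isT, ex j q g, d, d', b, true, true, true)
  | Wmark j q b d => (tg 5 isT, ex j q (mblank _), d, DS, b, true, true, true)
  | Ifind j q b d => (tg 6 isT, ex j q (mblank _), d, DS, b, true, true, true)
  | Imark j q => (tg 7 isT, ex j q (mblank _), DS, DS, true, true, true, true)
  | Count j q => (tg 8 isT, ex j q (mblank _), DS, DS, true, true, true, true)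
  | Tail => mk0 9 isT | Pick => mk0 10 isT
  | Reload j => (tg 11 isT, ex0 j, DS, DS, true, true, true, true)
  | Pidx j => (tg 12 isT, ex0 j, DS, DS, true, true, true, true)
  | Pwork j => (tg 13 isT, ex0 j, DS, DS, true, true, true, true)
  | Rd0 j q s d => (tg 14 isT, ex j q (mblank _), d, DS, s, true, true, true)
  | Rd1 j q s d o => (tg 15 isT, ex j q (mblank _), d, DS, s, o, true, true)
  | Rd2 j q s d o l => (tg 16 isT, ex j q (mblank _), d, DS, s, o, l, true)
  | Live j q o l b s => (tg 17 isT, ex j q (mblank _), DS, DS, s, o, l, b)
  | Back j q s b1 b0 => (tg 18 isT, ex j q (mblank _), DS, DS, s, b1, b0, true)
  | G0 => mk0 19 isT | G1 => mk0 20 isT | Ga => mk0 21 isT | Gb => mk0 22 isT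
  | Gc => mk0 23 isT | Z => mk0 24 isT | Acc => mk0 25 isT | Rej => mk0 26 isT
  end.

Definition ctl_decode (c : ctl_codeT) : ctl :=
  let: (n, existT j (q, g), d, d', b1, b2, b3, b4) := c in
  match val n with
  | 0 => Init0 | 1 => InitA | 2 => InitB
  | 3 => Copy q g b1
  | 4 => Wfind q g d b1 d'
  | 5 => Wmark q b1 d
  | 6 => Ifind q b1 d
  | 7 => Imark q
  | 8 => Count q
  | 9 => Tail | 10 => Pick
  | 11 => Reload j | 12 => Pidx j | 13 => Pwork j
  | 14 => Rd0 q b1 d
  | 15 => Rd1 q b1 d b2
  | 16 => Rd2 q b1 d b2 b3
  | 17 => Live q b2 b3 b4 b1
  | 18 => Back q b1 b2 b3
  | 19 => G0 | 20 => G1 | 21 => Ga | 22 => Gb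
  | 23 => Gc | 24 => Z | 25 => Acc | _ => Rej
  end.

Lemma ctl_codeK : cancel ctl_code ctl_decode. Proof. by case. Qed.
HB.instance Definition _ := Finite.copy ctl (can_type ctl_codeK).

(* First component: rewind the work head ([Some false]), or both the work and the
   index heads ([Some true]), to cell 0 before entering the control state. *)
Definition state : finType := (option bool * outcomes * ctl)%type.

Definition start j : ctl := @Copy j (mq0 _) (mblank _) false.

(** [r] is false after a counter overflow, where the index head already rests on cell 0, and true
    after the sweep of [Copy], which displaced both heads. *)
Definition next r j (oc : outcomes) (o : option (Q j)) : state :=
  (Some r, set_outcome oc o, if j then start false else Tail).

Definition is_blank s := if s is IBlank then true else false.

Definition init_track j : track j := (mblank (M j), true, false, true, ord0).

(** [Copy] writes the saved index on the index tape while it collects the symbols under the two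
    marks; at the first cell behind the region the input symbol is therefore the one that the
    simulated machine reads. Its first move of the choice head to the right is not carried out but
    ends the deterministic part. In [Live], the flag [o] decides between [None] and [Some b], a move
    to the right off a block flagged as last rejects, and a left move at the origin stays put, as
    [mv] does on cell 0. *)
Definition ctl_delta (oc : outcomes) (c : ctl) (s : isym) (a : cell) (ib : bool)
    (ch : option bool) : state * cell * dir * bool * dir * dir :=
  let: (tr, lf, vis) := a in
  let go c := (None, oc, c) in
  let upd j (v : track j) (vis : bool) : cell := (put tr v, lf, vis) in
  let bit := ch == Some true in
  match c with
  | Init0 => (go InitB, ((init_track true, init_track false), true, true), DS, true, DS, DS)
  | InitA => (go InitB, (tr, lf, true), DS, true, DS, DS)
  | InitB => if is_blank s then ((Some true, oc, start true), a, DS, false, DS, DS)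
             else (go InitA, a, DR, false, DR, DS)
  | Copy j q g b =>
      let: (sy, wm, bi, im, dg) := get j tr in
      if vis then
        (go (Copy q (if wm then sy else g) (if im then bi else b)), a, DR, bi, DR, DS)
      else if mhalt q then (next true oc (Some q), a, DS, ib, DS, DS)
      else let: (q', a', dw, b', di, dc) := mdelta q s g b None in
        (if dc is DR then next true oc (Some q)
         else (Some true, oc, Wfind q' a' dw b' di), a, DS, ib, DS, DS)
  | Wfind j q g dw b di =>
      let: (sy, wm, bi, im, dg) := get j tr in
      if wm then (go (Wmark q b di), upd j (g, false, bi, im, dg) vis, dw, ib, DS, DS)
      else (go c, a, DR, ib, DS, DS)
  | Wmark j q b di =>
      let: (sy, wm, bi, im, dg) := get j tr in
      ((Some false, oc, Ifind q b di), upd j (sy, true, bi, im, dg) true, DS, ib, DS, DS)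
  | Ifind j q b di =>
      let: (sy, wm, bi, im, dg) := get j tr in
      if im then (go (Imark q), upd j (sy, wm, b, false, dg) vis, di, ib, DS, DS)
      else (go c, a, DR, ib, DS, DS)
  | Imark j q =>
      let: (sy, wm, bi, im, dg) := get j tr in
      ((Some false, oc, Count q), upd j (sy, wm, bi, true, dg) true, DS, ib, DS, DS)
  | Count j q =>
      let: (sy, wm, bi, im, dg) := get j tr in
      if ~~ vis then (next false oc (None : option (Q j)), a, DS, ib, DS, DS)
      else if dg == ord_max then (go c, upd j (sy, wm, bi, im, ord0) vis, DR, ib, DS, DS)
      else ((Some false, oc, Copy q (mblank _) false),
            upd j (sy, wm, bi, im, inord dg.+1) vis, DS, ib, DS, DS)
  | Tail =>
      if ~~ isprod then (go Pick, a, DS, ib, DS, DR)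
      else if oc.1 && oc.2 then (go (Reload false), a, DS, ib, DS, DS)
      else (go Rej, a, DS, ib, DS, DS)
  | Pick => (go (if outcome bit oc then Reload bit else Rej), a, DS, ib, DS, DS)
  | Reload j =>
      let: (sy, wm, bi, im, dg) := get j tr in
      if vis then (go c, a, DR, bi, DR, DS)
      else ((Some true, oc, Pidx j), a, DS, ib, DS, DS)
  | Pidx j =>
      let: (sy, wm, bi, im, dg) := get j tr in
      if im then ((Some false, oc, Pwork j), a, DS, ib, DS, DS)
      else (go c, a, DR, ib, DR, DS)
  | Pwork j =>
      let: (sy, wm, bi, im, dg) := get j tr in
      if wm then
        if outcome j oc is Some q then (go (Rd0 q false DS), a, DS, ib, DS, DR)
        else (go Rej, a, DS, ib, DS, DS)
      else (go c, a, DR, ib, DS, DS)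
  | Rd0 j q sn d => (go (Rd1 q sn d bit), a, DS, ib, DS, DR)
  | Rd1 j q sn d o => (go (Rd2 q sn d o bit), a, DS, ib, DS, DR)
  | Rd2 j q sn d o l =>
      let fine := match d with DS => o && ~~ bit | DR => ~~ o | DL => true end in
      (go (if fine then Live q o l bit (sn || l) else Rej), a, DS, ib, DS, DS)
  | Live j q o l b sn =>
      let: (sy, wm, bi, im, dg) := get j tr in
      if mhalt q then
        if macc q && sn then
          if l then
            (if isprod && ~~ j then (Some false, oc, G0) else go Acc, a, DS, ib, DS, DS)
          else (go (Rd0 q sn DR), a, DS, ib, DS, DR)
        else (go Rej, a, DS, ib, DS, DS)
      else
        let: (q', g, dw, b', di, dc) := mdelta q s sy ib (if o then None else Some b) in
        let a' := upd j (g, wm, bi, im, dg) vis in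
        match dc with
        | DS => (go (Live q' o l b sn), a', dw, b', di, DS)
        | DR => if l then (go Rej, a, DS, ib, DS, DS)
                else (go (Rd0 q' sn DR), a', dw, b', di, DR)
        | DL => if o then (go (Live q' o l b sn), a', dw, b', di, DS)
                else (go (Back q' sn true true), a', dw, b', di, DL)
        end
  | Back j q sn b1 b0 =>
      (go (match b1, b0 with
           | true, true => Back q sn true false
           | true, false => Back q sn false true
           | false, true => Back q sn false false
           | false, false => Rd0 q sn DL
           end), a, DS, ib, DS, DL)
  | G0 => (go G1, a, DS, ib, DR, DS)
  | G1 => (go Ga, a, DS, false, DL, DS)
  | Ga => (go Gb, a, DS, true, DL, DS)
  | Gb => (go Gc, a, DS, false, DR, DS)
  | Gc => (go (if ib then Ga else Z), a, DS, false, DL, DS)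
  | Z => if vis || is_blank s then (go Z, a, DR, false, DR, DS)
         else ((Some true, oc, Reload true), a, DS, ib, DS, DS)
  | Acc | Rej => (go c, a, DS, ib, DS, DS)
  end.

Definition delta (q : state) (s : isym) (a : cell) (ib : bool) (ch : option bool) :
    state * cell * dir * bool * dir * dir :=
  let: (r, oc, c) := q in
  match r with
  | None => ctl_delta oc c s a ib ch
  | Some b => if a.1.2 then ((None, oc, c), a, DS, ib, DS, DS)
              else (q, a, DL, ib, if b then DL else DS, DS)
  end.

Definition halts (q : state) : bool :=
  if q is (None, _, c) then if c is (Acc | Rej) then true else false else false.
Definition accepts (q : state) : bool :=
  if q is (None, _, Acc) then true else false.

Definition combined : machine :=
  @Machine state cell (((mblank _, false, false, false, ord0), (mblank _, false, false, false, ord0)),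
      false, false)
    (None, (None, None), Init0) halts accepts delta.

End Machine.

(** * The deterministic part *)

Lemma is_blank_inp x k i : is_blank (inp x k i) = (size x + k < i).
Proof.
rewrite /inp; case: ltnP => h1; first by rewrite /=; lia.
case: eqP => h2; first by rewrite /=; lia.
by case: leqP.
Qed.

Lemma getput M j p v : @get M j (put p v) = v. Proof. by case: j v. Qed.
Lemma putput M j p (v w : track M j) : put (put p v) w = put p w. Proof. by case: j v w. Qed.
Section Run.
Variables (M : bool -> machine) (isprod : bool).
Variables (x : seq bool) (k : nat) (cc : nat -> bool).
Variables (sp Bc : nat) (ro : Prop).

Notation BM := (combined M isprod).
Notation stp := (@step BM x k cc).

Definition cfg r (oc : outcomes M) (c : ctl M) t wh idx ih ch : config BM :=
  @Config BM (r, oc, c) t wh idx ih ch.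

(** [ro] is a proposition, to be instantiated by [True] or [False], so that one trace lemma covers
    read-once and two-way machines; [sp + 4] leaves slack for sweeps that end behind the region. *)
Definition ok (cf : config BM) : Prop :=
  [/\ cwh cf <= sp + 4, cih cf <= sp + 4, cch cf <= Bc & ro -> cch cf <= cch (stp cf)].

Notation goes a b := (exists n, reach stp ok n a b).

Lemma goes_trans a b c : goes a b -> goes b c -> goes a c.
Proof. by move=> [m ab] [n bc]; exists (m + n); apply: reach_trans ab bc. Qed.

Lemma local_step q t wh idx ih ch q' a dw b di dc t' wh' idx' ih' ch' :
  ~~ halts q ->
  delta isprod q (inp x k idx) (t wh) (getbit idx ih) (chread cc ch) =
    (q', a, dw, b, di, dc) ->
  t' = (fun i => if i == wh then a else t i) ->
  setbit idx ih b = idx' ->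
  mv dw wh = wh' -> mv di ih = ih' -> mv dc ch = ch' ->
  wh <= sp + 4 -> ih <= sp + 4 -> ch <= Bc -> (ro -> ch <= ch') ->
  reach stp ok 1 (@Config BM q t wh idx ih ch) (@Config BM q' t' wh' idx' ih' ch').
Proof.
move=> nh de -> <- <- <- <- hw hi hc hr.
have e : stp (@Config BM q t wh idx ih ch) =
    @Config BM q' (fun i => if i == wh then a else t i) (mv dw wh)
      (setbit idx ih b) (mv di ih) (mv dc ch).
  by rewrite /step [mhalt _](negbTE nh) [mdelta _ _ _ _ _]de.
by apply: reach1 => //; split; rewrite ?e.
Qed.

Lemma same_tape (T : Type) (t : nat -> T) wh : t = (fun i => if i == wh then t wh else t i).
Proof. by apply: functional_extensionality => i; case: eqP => [->|]. Qed.

Lemma move_step q t wh idx ih ch q' dw b di dc wh' idx' ih' ch' :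
  ~~ halts q ->
  delta isprod q (inp x k idx) (t wh) (getbit idx ih) (chread cc ch) =
    (q', t wh, dw, b, di, dc) ->
  setbit idx ih b = idx' ->
  mv dw wh = wh' -> mv di ih = ih' -> mv dc ch = ch' ->
  wh <= sp + 4 -> ih <= sp + 4 -> ch <= Bc -> (ro -> ch <= ch') ->
  reach stp ok 1 (@Config BM q t wh idx ih ch) (@Config BM q' t wh' idx' ih' ch').
Proof. by move=> nh de; apply: local_step (nh) (de) _; apply: same_tape. Qed.

Lemma reach_family (F : nat -> config BM) e :
  (forall i, i < e -> reach stp ok 1 (F i) (F i.+1)) -> reach stp ok e (F 0) (F e).
Proof.
elim: e => [|e IH] H; first exact: reach0.
have IHe : reach stp ok e (F 0) (F e) by apply: IH => i hi; apply: H; lia.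
by have := reach_trans IHe (H _ (leqnn _)); rewrite addn1.
Qed.

Definition tape (T : nat -> track M true * track M false) s (i : nat) : cell M :=
  (T i, i == 0, i < s).

Definition left_marked (t : nat -> cell M) := forall i, (t i).1.2 = (i == 0).

Lemma rewind_work oc c t h idx ih ch :
  left_marked t -> h <= sp + 4 -> ih <= sp + 4 -> ch <= Bc ->
  reach stp ok h.+1 (cfg (Some false) oc c t h idx ih ch) (cfg None oc c t 0 idx ih ch).
Proof.
move=> lt hS iS cB; elim: h hS => [|h IH] hS.
  by apply: (@move_step _ _ _ _ _ _ _ DS (getbit idx ih) DS DS) => //=;
    rewrite ?lt ?setbit_getbit.
rewrite -add1n; apply: reach_trans (IH _); last by lia.
by apply: (@move_step _ _ _ _ _ _ _ DL (getbit idx ih) DS DS) => //=;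
    rewrite ?lt ?setbit_getbit.
Qed.

(** Only the work tape has a left-end mark. The index head gets back to cell 0 as well because both
    heads stand at the same distance [h]. *)
Lemma rewind_both oc c t h idx ch :
  left_marked t -> h <= sp + 4 -> ch <= Bc ->
  reach stp ok h.+1 (cfg (Some true) oc c t h idx h ch) (cfg None oc c t 0 idx 0 ch).
Proof.
move=> lt hS cB; elim: h hS => [|h IH] hS.
  by apply: (@move_step _ _ _ _ _ _ _ DS (getbit idx 0) DS DS) => //=;
    rewrite ?lt ?setbit_getbit.
rewrite -add1n; apply: reach_trans (IH _); last by lia.
by apply: (@move_step _ _ _ _ _ _ _ DL (getbit idx h.+1) DL DS) => //=;
    rewrite ?lt ?setbit_getbit.
Qed.

Definition upd j (U : nat -> track M true * track M false) (f : nat -> track M j) (i : nat) :=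
  put (U i) (f i).

Lemma tape_update j U (f f' : nat -> track M j) s s' wh :
  (forall i, i != wh -> f i = f' i) ->
  (forall i, i != wh -> (i < s) = (i < s')) ->
  tape (upd U f') s' =
  (fun i => if i == wh then (put (upd U f wh) (f' wh), wh == 0, wh < s') else tape (upd U f) s i).
Proof.
move=> H1 H2; apply: functional_extensionality => i; rewrite /tape /upd putput.
by have [->|ne] := eqVneq i wh; rewrite ?(H1 _ ne) ?(H2 _ ne).
Qed.

Definition dig j n i : 'I_(lim M j).+1 := inord ((n %/ (lim M j).+1 ^ i) %% (lim M j).+1).

Definition enc j (r : config (M j)) n (i : nat) : track M j :=
  (cwork r i, i == cwh r, getbit (cidx r) i, i == cih r, dig j n i).

Notation dstep j := (@step (M j) x k (fun=> false)).
Notation det j n := (run (M j) x k (fun=> false) n).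

Definition wants_choice j (r : config (M j)) : bool :=
  let: (_, _, _, _, _, dc) :=
     mdelta (cq r) (inp x k (cidx r)) (cwork r (cwh r)) (getbit (cidx r) (cih r)) None in
  if dc is DR then true else false.

Definition stops j (r : config (M j)) := mhalt (cq r) || wants_choice r.

(* The cells [0], ..., [s - 1] contain everything that [r] has touched. *)
Definition within j s (r : config (M j)) :=
  [/\ cwh r < s, cih r < s, cidx r < 2 ^ s & forall i, s <= i -> cwork r i = mblank (M j)].

Lemma within_le j s s' (r : config (M j)) : s <= s' -> within s r -> within s' r.
Proof.
move=> ss [h1 h2 h3 h4]; split; try lia.
  by apply: leq_trans h3 _; rewrite leq_exp2l.
by move=> i si; apply: h4; lia.
Qed.

Lemma within_step j s c (r : config (M j)) : within s r ->
  within (maxn s (maxn (cwh (step x k c r)).+1 (cih (step x k c r)).+1)) (step x k c r).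
Proof.
move=> wr; set s' := maxn _ _.
have [h1 h2 h3 h4] : within s' r by apply: within_le wr; rewrite /s'; lia.
split; rewrite -?/s'; try by rewrite /s'; lia.
  rewrite /step; case: ifP => // _; case: mdelta => [[[[[q a] dw] b] di] dc] /=.
  exact: setbit_ltn.
move=> i si; move: (h4 i si); rewrite /step; case: ifP => // _.
case: mdelta => [[[[[q a] dw] b] di] dc] /=; case: eqP => //; lia.
Qed.


Lemma copy_sweep j oc U (r : config (M j)) n s q idx :
  s <= sp + 4 -> idx < 2 ^ s -> within s r ->
  let t := tape (upd U (enc r n)) s in
  reach stp ok s (cfg None oc (Copy q (mblank _) false) t 0 idx 0 0)
    (cfg None oc (Copy q (cwork r (cwh r)) (getbit (cidx r) (cih r))) t s (cidx r) s 0).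
Proof.
move=> sS ids [h1 h2 h3 h4] t.
(* Invariant after [i] cells: a symbol is known once its mark has been passed, and the index tape
   holds the saved bits below [i] and the old ones from there on. *)
pose F i := cfg None oc (Copy q (if cwh r < i then cwork r (cwh r) else mblank _)
   ((cih r < i) && getbit (cidx r) (cih r))) t i (putbits (getbit (cidx r)) idx i) i 0.
have -> : cfg None oc (Copy q (mblank _) false) t 0 idx 0 0 = F 0 by [].
set e := cfg _ _ _ _ _ _ _ _; have -> : e = F s by rewrite /F /e h1 h2 putbits_all.
apply: reach_family => i lti.
apply: (@move_step _ _ _ _ _ _ _ DR (getbit (cidx r) i) DR DS) => //=; try lia.
have e1 : (if i == cwh r then cwork r i else if cwh r < i then cwork r (cwh r) else mblank _)
    = if cwh r < i.+1 then cwork r (cwh r) else mblank _.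
  by have [->|ne] := eqVneq i (cwh r); rewrite ltnS ?leqnn // [in RHS]leq_eqVlt eq_sym (negbTE ne).
have e2 : (if i == cih r then getbit (cidx r) i else (cih r < i) && getbit (cidx r) (cih r))
    = (cih r < i.+1) && getbit (cidx r) (cih r).
  by have [->|ne] := eqVneq i (cih r); rewrite ltnS ?leqnn // [in RHS]leq_eqVlt eq_sym (negbTE ne).
by rewrite /t /upd getput /= lti e1 e2.
Qed.

Lemma seek_work oc c t h idx ih ch :
  ~~ halts (None, oc, c) ->
  (forall i, i < h -> delta isprod (None, oc, c) (inp x k idx) (t i) (getbit idx ih) (chread cc ch) =
     ((None, oc, c), t i, DR, getbit idx ih, DS, DS)) ->
  h <= sp + 4 -> ih <= sp + 4 -> ch <= Bc ->
  reach stp ok h (cfg None oc c t 0 idx ih ch) (cfg None oc c t h idx ih ch).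
Proof.
move=> nh de hS iS cB; apply: (@reach_family (fun i => cfg None oc c t i idx ih ch)) => i lti.
by apply: move_step (de i lti) _ _ _ _ _ _ _ _ => //=; rewrite ?setbit_getbit //; lia.
Qed.

Lemma seek_both oc c t h idx ch :
  ~~ halts (None, oc, c) ->
  (forall i ib, i < h -> delta isprod (None, oc, c) (inp x k idx) (t i) ib (chread cc ch) =
     ((None, oc, c), t i, DR, ib, DR, DS)) ->
  h <= sp + 4 -> ch <= Bc ->
  reach stp ok h (cfg None oc c t 0 idx 0 ch) (cfg None oc c t h idx h ch).
Proof.
move=> nh de hS cB; apply: (@reach_family (fun i => cfg None oc c t i idx i ch)) => i lti.
by apply: move_step (de i _ lti) _ _ _ _ _ _ _ _ => //=; rewrite ?setbit_getbit //; lia.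
Qed.

Lemma mv_le d p : mv d p <= p.+1.
Proof. by case: d => /=; lia. Qed.

(** The mark is lifted, carried along [dw] and put down; putting it down also sets the visited flag.
    Since [h < s], the new position is at most [s], so the visited cells remain an initial
    segment. *)
Lemma work_round j oc U s (f f' : nat -> track M j) (q : mQ (M j)) g dw b di h idx :
  (forall i, (f i).1.1.1.2 = (i == h)) ->
  h < s -> s <= sp + 1 ->
  (forall i, f' i = (if i == h then g else (f i).1.1.1.1, i == mv dw h, (f i).1.1.2, (f i).1.2, (f i).2)) ->
  goes (cfg None oc (Wfind q g dw b di) (tape (upd U f) s) 0 idx 0 0)
    (cfg None oc (Ifind q b di) (tape (upd U f') (maxn s (mv dw h).+1)) 0 idx 0 0).
Proof.
move=> fh hs sS f'E; have := mv_le dw h; set h' := mv dw h => h'le.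
pose f1 i : track M j := (if i == h then g else (f i).1.1.1.1, false, (f i).1.1.2, (f i).1.2, (f i).2).
apply: (@goes_trans _ (cfg None oc (Wfind q g dw b di) (tape (upd U f) s) h idx 0 0)).
  exists h; apply: seek_work => //; last by lia.
  move=> i hi; have := fh i; rewrite /= /upd getput; case: (f i) => [[[[a w] bi] im] dg] /= ->.
  by rewrite ifN //; lia.
apply: (@goes_trans _ (cfg None oc (Wmark q b di) (tape (upd U f1) s) h' idx 0 0)).
  exists 1.
  apply: (@local_step _ _ _ _ _ _ _ (put (upd U f h) (f1 h), h == 0, h < s) dw (getbit idx 0) DS DS) => //=; try lia.
  - have := fh h; rewrite /f1 eqxx /= /upd getput; by case: (f h) => [[[[a w] bi] im] dg] /= ->.
  - apply: tape_update => // i /negbTE ne; have := fh i; rewrite /f1 ne.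
    by case: (f i) => [[[[a w] bi] im] dg] /= ->.
  - by rewrite setbit_getbit.
set s' := maxn _ _.
apply: (@goes_trans _ (cfg (Some false) oc (Ifind q b di) (tape (upd U f') s') h' idx 0 0)); last first.
  by exists h'.+1; apply: rewind_work => //; lia.
exists 1; apply: (@local_step _ _ _ _ _ _ _ (put (upd U f1 h') (f' h'), h' == 0, h' < s') DS (getbit idx 0) DS DS) => //=; try lia.
- by rewrite /upd getput f'E eqxx /f1; have -> : h' < s' by lia.
- apply: tape_update => i ne; first by rewrite f'E /f1 (negbTE ne).
  by rewrite /s'; lia.
- by rewrite setbit_getbit.
Qed.

Lemma index_round j oc U s (f f' : nat -> track M j) (q : mQ (M j)) b di h idx :
  (forall i, (f i).1.2 = (i == h)) ->
  h < s -> s <= sp + 2 ->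
  (forall i, f' i = ((f i).1.1.1.1, (f i).1.1.1.2, if i == h then b else (f i).1.1.2, i == mv di h, (f i).2)) ->
  goes (cfg None oc (Ifind q b di) (tape (upd U f) s) 0 idx 0 0)
    (cfg None oc (Count q) (tape (upd U f') (maxn s (mv di h).+1)) 0 idx 0 0).
Proof.
move=> fh hs sS f'E; have := mv_le di h; set h' := mv di h => h'le.
pose f1 i : track M j := ((f i).1.1.1.1, (f i).1.1.1.2, if i == h then b else (f i).1.1.2, false, (f i).2).
apply: (@goes_trans _ (cfg None oc (Ifind q b di) (tape (upd U f) s) h idx 0 0)).
  exists h; apply: seek_work => //; last by lia.
  move=> i hi; have := fh i; rewrite /= /upd getput; case: (f i) => [[[[a w] bi] im] dg] /= ->.
  by rewrite ifN //; lia.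
apply: (@goes_trans _ (cfg None oc (Imark q) (tape (upd U f1) s) h' idx 0 0)).
  exists 1.
  apply: (@local_step _ _ _ _ _ _ _ (put (upd U f h) (f1 h), h == 0, h < s) di (getbit idx 0) DS DS) => //=; try lia.
  - have := fh h; rewrite /f1 eqxx /= /upd getput; by case: (f h) => [[[[a w] bi] im] dg] /= ->.
  - apply: tape_update => // i /negbTE ne; have := fh i; rewrite /f1 ne.
    by case: (f i) => [[[[a w] bi] im] dg] /= ->.
  - by rewrite setbit_getbit.
set s' := maxn _ _.
apply: (@goes_trans _ (cfg (Some false) oc (Count q) (tape (upd U f') s') h' idx 0 0)); last first.
  by exists h'.+1; apply: rewind_work => //; lia.
exists 1; apply: (@local_step _ _ _ _ _ _ _ (put (upd U f1 h') (f' h'), h' == 0, h' < s') DS (getbit idx 0) DS DS) => //=; try lia.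
- by rewrite /upd getput f'E eqxx /f1; have -> : h' < s' by lia.
- apply: tape_update => i ne; first by rewrite f'E /f1 (negbTE ne).
  by rewrite /s'; lia.
- by rewrite setbit_getbit.
Qed.

(** Adding 1 to [n] carries into digit [i] exactly if the [i]-th power of the base divides [n.+1].
    Then the quotient grows by one, and it becomes divisible by the base exactly if the old digit
    was maximal, that is, if the carry moves on. *)
Lemma dig_carry j n i : (lim M j).+1 ^ i %| n.+1 ->
  (dig j n i == ord_max) = ((lim M j).+1 ^ i.+1 %| n.+1).
Proof.
set B := (lim M j).+1 => dn; have B0 : 0 < B ^ i by rewrite expn_gt0.
have := divnS n B0; rewrite dn => e.
have -> : (dig j n i == ord_max) = ((n %/ B ^ i) %% B == B.-1).
  by rewrite -val_eqE /= inordK // ltn_mod.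
rewrite expnS -dvdn_divRL // e add1n /dvdn -addn1 -modnDml; move: (_ %% B) (ltn_mod (n %/ B ^ i) B) => m.
rewrite {1}/B => mB; have [->|ne] := eqVneq m B.-1; first by rewrite addn1 prednK // modnn.
by rewrite modn_small ?addn1 //; lia.
Qed.

Lemma dig_zero j n i : (lim M j).+1 ^ i.+1 %| n -> dig j n i = ord0.
Proof.
move=> /dvdnP[m ->]; apply: val_inj; rewrite /= inordK ?ltn_mod //.
by rewrite expnS mulnA mulnK ?expn_gt0 // modnMl.
Qed.

Lemma dig_incr j n i : (lim M j).+1 ^ i %| n.+1 -> ~~ ((lim M j).+1 ^ i.+1 %| n.+1) ->
  dig j n.+1 i = inord (dig j n i).+1.
Proof.
move=> dn ndn; have := dig_carry dn; rewrite (negbTE ndn) -val_eqE /=.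
rewrite /dig inordK ?ltn_mod //; set B := (lim M j).+1 => /= ne.
have B0 : 0 < B ^ i by rewrite expn_gt0.
rewrite divnS // dn add1n; congr inord; rewrite -addn1 -modnDml addn1 modn_small //.
by have := ltn_mod (n %/ B ^ i) B; rewrite {1}/B => h; rewrite ltn_neqAle h eqSS ne.
Qed.

Lemma dig_same j n i : ~~ ((lim M j).+1 ^ i %| n.+1) -> dig j n.+1 i = dig j n i.
Proof. by move=> nd; rewrite /dig divnS ?expn_gt0 // (negbTE nd). Qed.

(** On overflow the contents [g] of the track are left unspecified: the simulated machine loops, and
    its configuration will not be reloaded. *)
Lemma count_round j oc U s (f f' : nat -> track M j) (q : mQ (M j)) idx n :
  (forall i, (f i).2 = dig j n i) -> (forall i, f' i = ((f i).1, dig j n.+1 i)) ->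
  s <= sp + 2 -> n < (lim M j).+1 ^ s ->
  exists g : nat -> track M j,
  goes (cfg None oc (Count q) (tape (upd U f) s) 0 idx 0 0)
   (if n.+1 < (lim M j).+1 ^ s
    then cfg None oc (Copy q (mblank _) false) (tape (upd U f') s) 0 idx 0 0
    else cfg None (set_outcome oc (None : option (mQ (M j)))) (if j then start M false else Tail M)
           (tape (upd U g) s) 0 idx 0 0).
Proof.
move=> fE f'E sS ns; set B := (lim M j).+1 in ns *.
have B1 : 1 < B by rewrite /B ltnS muln_gt0; apply/andP; split; apply/card_gt0P;
  [exists (mq0 _) | exists (mblank _, true, true, true)].
(* [t] will be the digit that absorbs the carry. It exists because [B ^ n.+1] exceeds [n.+1]. *)
have ext : exists t, ~~ (B ^ t.+1 %| n.+1).
  exists n; apply/negP => h; have := dvdn_leq (ltn0Sn n) h.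
  by rewrite leqNgt ltn_expl.
case: (ex_minnP ext) => t tP tmin.
have dt i : i <= t -> B ^ i %| n.+1.
  case: i => [|i] it; first by rewrite expn0 dvd1n.
  by apply/negPn/negP => /tmin; lia.
pose g i m : track M j := ((f m).1, if m < i then dig j n.+1 m else dig j n m).
have g0 : upd U f = upd U (g 0).
  apply: functional_extensionality => i; rewrite /upd /g /= -fE.
  by case: (f i).
pose F i := cfg None oc (Count q) (tape (upd U (g i)) s) i idx 0 0.
have sweep e : e <= t -> e <= s -> goes (F 0) (F e).
  move=> et es; exists e; apply: reach_family => i ie.
  apply: (@local_step _ _ _ _ _ _ _ (put (upd U (g i) i) (g i.+1 i), i == 0, i < s)
     DR (getbit idx 0) DS DS) => //=; try lia.
  - have is' : i < s by lia.
    rewrite /upd getput /g ltnn ltnS leqnn /=; case: (f i) => [[[[a w] bi] im] dg] /=.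
    have d1 : B ^ i %| n.+1 by apply: dt; lia.
    have d2 : B ^ i.+1 %| n.+1 by apply: dt; lia.
    by rewrite is' /= dig_carry // -/B d2 (dig_zero d2).
  - by apply: tape_update => m ne //; rewrite /g ltnS [m <= i]leq_eqVlt (negbTE ne).
  - by rewrite setbit_getbit.
(* If [s <= t], the carry runs out of the region: [B ^ s] divides [n.+1], so the counter overflows.
   Otherwise digit [t] is incremented, the lower ones having become zero. *)
rewrite g0; case: (leqP s t) => st.
  exists (g s); have dvs := dt _ st; rewrite ifN; last first.
    by rewrite -leqNgt; apply: dvdn_leq.
  apply: (@goes_trans _ (F s)); first by apply: sweep.
  apply: (@goes_trans _ (cfg (Some false) (set_outcome oc (None : option (mQ (M j)))) (if j then start M false else Tail M)
           (tape (upd U (g s)) s) s idx 0 0)); last first.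
    by exists s.+1; apply: rewind_work => //; lia.
  exists 1; apply: (@move_step _ _ _ _ _ _ _ DS (getbit idx 0) DS DS) => //=; try lia.
    by rewrite ltnn /=; case: get => [[[[a w] bi] im] dg].
  by rewrite setbit_getbit.
have nds : ~~ (B ^ s %| n.+1).
  by apply: contra tP => /(dvdn_trans _); apply; apply: dvdn_exp2l.
exists f; rewrite ifT; last first.
  by rewrite ltn_neqAle ns andbT; apply: contra nds => /eqP->.
apply: (@goes_trans _ (F t)); first by apply: sweep => //; lia.
apply: (@goes_trans _ (cfg (Some false) oc (Copy q (mblank _) false) (tape (upd U f') s) t idx 0 0)); last first.
  by exists t.+1; apply: rewind_work => //; lia.
exists 1; apply: (@local_step _ _ _ _ _ _ _ (put (upd U (g t) t) (f' t), t == 0, t < s)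
     DS (getbit idx 0) DS DS) => //=; try lia.
- rewrite st /upd getput /g ltnn f'E /=; case: (f t) => [[[[a w] bi] im] dg] /=.
  by rewrite (dig_carry (dt _ (leqnn t))) -/B (negbTE tP) (dig_incr (dt _ (leqnn t)) tP).
- apply: tape_update => m ne //; rewrite f'E /g; case: ltnP => // tm.
  rewrite dig_same //; apply: contra tP => /(dvdn_trans _); apply; apply: dvdn_exp2l.
  by lia.
- by rewrite setbit_getbit.
Qed.

Lemma stops_step j (r : config (M j)) : cch r = 0 -> ~~ stops r -> cch (dstep j r) = 0.
Proof.
rewrite /stops /wants_choice /step => c0; case: ifP => // _; rewrite c0 /=.
by case: mdelta => [[[[[q a] dw] b] di] []].
Qed.

Lemma det_stop j oc U s n idx (r : config (M j)) :
  s <= sp + 1 -> idx < 2 ^ s -> within s r -> stops r ->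
  goes (cfg None oc (Copy (cq r) (mblank _) false) (tape (upd U (enc r n)) s) 0 idx 0 0)
    (cfg None (set_outcome oc (Some (cq r))) (if j then start M false else Tail M)
       (tape (upd U (enc r n)) s) 0 (cidx r) 0 0).
Proof.
move=> sS ids wr sr.
apply: goes_trans; first by exists s; apply: (copy_sweep oc U n (cq r) _ ids wr); lia.
apply: (@goes_trans _ (cfg (Some true) (set_outcome oc (Some (cq r)))
  (if j then start M false else Tail M) (tape (upd U (enc r n)) s) s (cidx r) s 0)); last first.
  by exists s.+1; apply: rewind_both => //; lia.
exists 1; apply: (@move_step _ _ _ _ _ _ _ DS (getbit (cidx r) s) DS DS) => //=; try lia; last first.
  by rewrite setbit_getbit.
rewrite ltnn; case: get => [[[[a w] bi] im] dg]; move: sr; rewrite /stops /wants_choice.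
case: ifP => //= _; case: mdelta => [[[[[q' a'] dw] b'] di] []] //.
Qed.

Lemma det_round j oc U s n idx (r : config (M j)) (r' := dstep j r)
    (s' := maxn s (maxn (cwh r').+1 (cih r').+1)) :
  s <= sp + 1 -> idx < 2 ^ s -> within s r -> cch r = 0 -> n < (lim M j).+1 ^ s ->
  ~~ stops r -> cwh r' <= sp -> cih r' <= sp ->
  exists g : nat -> track M j,
  goes (cfg None oc (Copy (cq r) (mblank _) false) (tape (upd U (enc r n)) s) 0 idx 0 0)
   (if n.+1 < (lim M j).+1 ^ s'
    then cfg None oc (Copy (cq r') (mblank _) false) (tape (upd U (enc r' n.+1)) s') 0 (cidx r) 0 0
    else cfg None (set_outcome oc (None : option (mQ (M j)))) (if j then start M false else Tail M)
           (tape (upd U g) s') 0 (cidx r) 0 0).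
Proof.
move=> sS ids wr c0 nB nst r'w r'i.
have [h1 h2 h3 h4] := wr.
have s'sp : s' <= sp + 1 by rewrite /s'; lia.
have nB' : n < (lim M j).+1 ^ s'.
  by apply: leq_trans nB _; rewrite leq_pexp2l // /s' leq_maxl.
move: (nst); rewrite /stops negb_or => /andP[nh]; rewrite /wants_choice.
case E : (mdelta _ _ _ _ None) => [[[[[q' a'] dw] b'] di] dc] ndr.
have r'E : r' = Config q' (fun i => if i == cwh r then a' else cwork r i) (mv dw (cwh r))
    (setbit (cidx r) (cih r) b') (mv di (cih r)) (mv dc (cch r)).
  by rewrite /r' /step (negbTE nh) c0 /= E.
pose f2 i : track M j := (if i == cwh r then a' else cwork r i, i == mv dw (cwh r),
  getbit (cidx r) i, i == cih r, dig j n i).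
pose f3 i : track M j := (if i == cwh r then a' else cwork r i, i == mv dw (cwh r),
  if i == cih r then b' else getbit (cidx r) i, i == mv di (cih r), dig j n i).
have [||||g cg] := @count_round j oc U s' f3 (enc r' n.+1) (cq r') (cidx r) n => //.
- by move=> i; rewrite /enc r'E /= getbit_setbit.
- by lia.
exists g; apply: goes_trans cg.
apply: goes_trans; first by exists s; apply: (copy_sweep oc U n (cq r) _ ids wr); lia.
apply: (@goes_trans _ (cfg (Some true) oc (Wfind q' a' dw b' di) (tape (upd U (enc r n)) s)
  s (cidx r) s 0)).
  exists 1; apply: (@move_step _ _ _ _ _ _ _ DS (getbit (cidx r) s) DS DS) => //=; try lia; last first.
    by rewrite setbit_getbit.
  rewrite ltnn; case: get => [[[[a w] bi] im] dg]; rewrite (negbTE nh) E.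
  by case: dc E ndr {r'E}.
apply: goes_trans; first by exists s.+1; apply: rewind_both => //; lia.
apply: goes_trans.
  by apply: (@work_round j oc U s (enc r n) f2 q' a' dw b' di (cwh r)).
rewrite (_ : s' = maxn (maxn s (mv dw (cwh r)).+1) (mv di (cih r)).+1); last first.
  by rewrite -maxnA /s' r'E.
rewrite r'E; apply: index_round => //; first by rewrite leq_max h2.
by move: s'sp; rewrite /s' r'E /=; lia.
Qed.

Lemma detS j n : det j n.+1 = dstep j (det j n).
Proof. by []. Qed.

Lemma det_choice0 j n : (forall m, m < n -> ~~ stops (det j m)) -> cch (det j n) = 0.
Proof.
elim: n => // n IH H; apply: stops_step; last exact: H.
by apply: IH => m mn; apply: H; lia.
Qed.

Lemma config_ext (N : machine) (r r' : config N) :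
  cq r = cq r' -> cwork r = cwork r' -> cwh r = cwh r' -> cidx r = cidx r' ->
  cih r = cih r' -> cch r = cch r' -> r = r'.
Proof. by case: r => ??????; case: r' => ?????? /=; do 6 move=> ->. Qed.

(* There are fewer configurations within the region than values of the counter. *)
Lemma det_loop j s n : 0 < s -> (lim M j).+1 ^ s <= n.+1 ->
  (forall m, m <= n -> within s (det j m)) -> (forall m, m <= n -> ~~ stops (det j m)) ->
  forall m, ~~ stops (det j m).
Proof.
move=> s0 ln wr nst.
pose snap m : mQ (M j) * s.-tuple (content M j) :=
  (cq (det j m), [tuple (cwork (det j m) i, (i : nat) == cwh (det j m), getbit (cidx (det j m)) i,
                 (i : nat) == cih (det j m)) | i < s]).
have /injectivePn[a [b neab eab]] : ~~ injectiveb (fun m : 'I_n.+1 => snap m).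
  apply/negP => /injectiveP inj.
  have := leq_card _ inj; rewrite card_ord card_prod card_tuple leqNgt.
  case/negP; apply: leq_trans ln; have Q0 : 0 < #|mQ (M j)| by apply/card_gt0P; exists (mq0 _).
  apply: (@leq_trans ((lim M j).+1 ^ s)) => //.
  apply: (@leq_ltn_trans (lim M j ^ s)); last by rewrite ltn_exp2r.
  by rewrite /lim expnMn leq_mul2r -{1}[#|mQ _|]expn1 leq_pexp2l ?orbT.
wlog ab : a b neab eab / a < b.
  move=> W; case: (ltngtP a b) => h; [exact: (W a b)|apply: (W b a) => //|].
    by rewrite eq_sym.
  by case/eqP: neab; apply: val_inj.
have rab : det j a = det j b.
  have [wa1 wa2 wa3 wa4] := wr a (leq_ord a); have [wb1 wb2 wb3 wb4] := wr b (leq_ord b).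
  have eq := congr1 fst eab; have /= et := congr1 snd eab.
  have {}et i : i < s -> (cwork (det j a) i, i == cwh (det j a), getbit (cidx (det j a)) i,
      i == cih (det j a)) = (cwork (det j b) i, i == cwh (det j b), getbit (cidx (det j b)) i,
      i == cih (det j b)).
    move=> is'; pose i' := Ordinal is'; have := congr1 (fun t => tnth t i') et.
    by rewrite !tnth_mktuple.
  apply: config_ext => //.
  - apply: functional_extensionality => i; case: (ltnP i s) => is'.
      by case: (et i is').
    by rewrite wa4 // wb4.
  - by have [_ + _ _] := et _ wa1; rewrite eqxx => /esym/eqP.
  - apply: getbit_inj => i; case: (ltnP i s) => is'; first by case: (et i is').
    by rewrite (getbit_small wa3) // (getbit_small wb3).
  - by have [_ _ _] := et _ wa2; rewrite eqxx => /esym/eqP.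
  - by rewrite !det_choice0 // => m hm; apply: nst; have := ltn_ord a; have := ltn_ord b; lia.
(* The repetition makes the run periodic: a time beyond [n] is folded back by [b - a]. *)
move=> m; elim/ltn_ind: m => m IH; case: (leqP m n) => mn; first exact: nst.
have bm : b <= m by have := ltn_ord b; lia.
have -> : det j m = det j (a + (m - b)); last by apply: IH; lia.
by rewrite -{1}(subnK bm) /run iterD -/(det j b) -rab -iterD addnC.
Qed.

Hypothesis space : forall j c n, cwh (run (M j) x k c n) <= sp /\ cih (run (M j) x k c n) <= sp.

(* [None] records that the simulated machine never leaves its deterministic part. *)
Definition det_outcome j s (f : nat -> track M j) (o : option (mQ (M j))) : Prop :=
  if o is Some q then
    exists n, [/\ q = cq (det j n), stops (det j n), forall m, m < n -> ~~ stops (det j m),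
                  within s (det j n) & f = enc (det j n) n]
  else forall m, ~~ stops (det j m).

(** Each round increases [n], which stays below [(lim M j).+1 ^ s] with [s <= sp + 1]; the induction
    is on its distance from [(lim M j).+1 ^ (sp + 1)]. [U] is arbitrary and keeps the other
    track. *)
Lemma det_phase_from j oc U n s idx :
  0 < s -> s <= sp + 1 -> idx < 2 ^ s -> n < (lim M j).+1 ^ s ->
  (forall m, m < n -> ~~ stops (det j m)) -> (forall m, m <= n -> within s (det j m)) ->
  exists s' idx' (f : nat -> track M j) o,
    [/\ s <= s', s' <= sp + 1, idx' < 2 ^ s', det_outcome s' f o &
    goes (cfg None oc (Copy (cq (det j n)) (mblank _) false) (tape (upd U (enc (det j n) n)) s) 0 idx 0 0)
         (cfg None (set_outcome oc o) (if j then start M false else Tail M) (tape (upd U f) s') 0 idx' 0 0)].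
Proof.
have [N] := ubnP ((lim M j).+1 ^ (sp + 1) - n).
elim: N n s idx => // N IH n s idx nN s0 sS ids nB nst wr.
have wn := wr n (leqnn n).
have [st|nstn] := boolP (stops (det j n)).
  exists s, (cidx (det j n)), (enc (det j n) n), (Some (cq (det j n))).
  split=> //; first by case: wn.
    by exists n.
  exact: det_stop.
have nst' m : m <= n -> ~~ stops (det j m) by rewrite leq_eqVlt => /orP[/eqP->|/nst].
have := @det_round j oc U s n idx (det j n) sS ids wn (det_choice0 nst) nB nstn.
rewrite -!detS; set s' := maxn _ _.
have [hw hi] := @space j (fun=> false) n.+1.
case=> // g; have ss' : s <= s' by rewrite /s' leq_maxl.
have s'sp : s' <= sp + 1 by rewrite /s'; lia.
have wr' m : m <= n.+1 -> within s' (det j m).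
  rewrite leq_eqVlt => /orP[/eqP->|]; last by rewrite ltnS => /wr; apply: within_le.
  exact: within_step.
case: ltnP => nB' go; last first.
  exists s', (cidx (det j n)), g, None; split=> //.
    by have [] := wr' n (leqnSn n).
  apply: (@det_loop j s' n) => //; first by lia.
  by move=> m mn; apply: wr'; lia.
have BS : (lim M j).+1 ^ s' <= (lim M j).+1 ^ (sp + 1) by rewrite leq_pexp2l.
have [|||||||s'' [idx' [f [o [h1 h2 h3 h4 h5]]]]] := IH n.+1 s' (cidx (det j n)) => //.
- by lia.
- by lia.
- by have [] := wr' n (leqnSn n).
exists s'', idx', f, o; split=> //; first by lia.
exact: goes_trans go h5.
Qed.

Lemma det_phase j oc U s idx :
  0 < s -> s <= sp + 1 -> idx < 2 ^ s ->
  exists s' idx' (f : nat -> track M j) o,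
    [/\ s <= s', s' <= sp + 1, idx' < 2 ^ s', det_outcome s' f o &
    goes (cfg None oc (start M j) (tape (upd U (enc (det j 0) 0)) s) 0 idx 0 0)
         (cfg None (set_outcome oc o) (if j then start M false else Tail M) (tape (upd U f) s') 0 idx' 0 0)].
Proof.
move=> s0 sS ids; apply: (@det_phase_from j oc U 0) => //; first by rewrite expn_gt0.
by case=> // _; split=> //=; rewrite expn_gt0.
Qed.

Hypothesis size_S : size x + k < 2 ^ sp.

Definition tape0 := upd (fun i => (enc (det true 0) 0 i, enc (det false 0) 0 i)) (enc (det true 0) 0).

Lemma enc0 j i : enc (det j 0) 0 i = (mblank (M j), i == 0, false, i == 0, ord0).
Proof.
rewrite /enc /= getbit0n; congr (_, _); apply: val_inj.
by rewrite /dig div0n mod0n /= inordK.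
Qed.

Lemma setbit0 p : setbit 0 p true = 2 ^ p.
Proof. by rewrite /setbit getbit0n mul1n. Qed.

Lemma setbit_pow p : setbit (2 ^ p) p false = 0.
Proof. by rewrite /setbit /getbit divnn expn_gt0 mul1n subnn. Qed.

(** An index tape with a single 1 in cell [p] addresses position [2 ^ p], which is blank exactly if
    [size x + k < 2 ^ p]. Trying [p = 0, 1, ...] stops at the least such [p], and [size_S] bounds it
    by [sp]. *)
Lemma init_phase : exists s,
  [/\ 0 < s, s <= sp + 1, size x + k < 2 ^ s &
   goes (init BM) (cfg None (None, None) (start M true) (tape tape0 s) 0 0 0 0)].
Proof.
pose oc : outcomes M := (None, None).
have t0 i : tape0 i = (enc (det true 0) 0 i, enc (det false 0) 0 i) by [].
have go0 : goes (init BM) (cfg None oc (InitB M) (tape tape0 1) 0 (2 ^ 0) 0 0).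
  exists 1; apply: (@local_step _ _ _ _ _ _ _ ((init_track M true, init_track M false), true, true)
    DS true DS DS) => //=.
  apply: functional_extensionality => i; rewrite /tape t0 !enc0.
  by case: eqP => [->|] //=; case: i.
have [p [pS lp go]] : exists p, [/\ p <= sp, size x + k < 2 ^ p &
    goes (init BM) (cfg None oc (InitB M) (tape tape0 p.+1) p (2 ^ p) p 0)].
  have ex : exists p, size x + k < 2 ^ p by exists sp.
  case: (ex_minnP ex) => p hp pmin; exists p; split=> //; first by apply: pmin.
  have pS : p <= sp by apply: pmin.
  suff H q : q <= p -> goes (init BM) (cfg None oc (InitB M) (tape tape0 q.+1) q (2 ^ q) q 0).
    exact: H.
  elim: q => // q IH qp; apply: goes_trans (IH _) _; first by lia.
  apply: (@goes_trans _ (cfg None oc (InitA M) (tape tape0 q.+1) q.+1 0 q.+1 0)).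
    exists 1; apply: (@move_step _ _ _ _ _ _ _ DR false DR DS) => //=; try lia.
      rewrite is_blank_inp ifN //; apply/negP => /pmin; lia.
    exact: setbit_pow.
  exists 1; apply: (@local_step _ _ _ _ _ _ _ (tape tape0 q.+2 q.+1) DS true DS DS) => //=; try lia.
  - by rewrite /tape ltnSn.
  - apply: functional_extensionality => i; have [->|ne] := eqVneq i q.+1 => //.
    by rewrite /tape; congr (_, _); lia.
  - exact: setbit0.
exists p.+1; split=> //; first by lia.
  by apply: leq_trans lp _; rewrite leq_exp2l.
apply: goes_trans go _.
apply: (@goes_trans _ (cfg (Some true) oc (start M true) (tape tape0 p.+1) p 0 p 0)).
  exists 1; apply: (@move_step _ _ _ _ _ _ _ DS false DS DS) => //=; try lia.
    by rewrite is_blank_inp lp.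
  exact: setbit_pow.
by exists p.+1; apply: rewind_both => //; lia.
Qed.

Lemma det_part : exists s idx (f1 : nat -> track M true) (f2 : nat -> track M false) o1 o2,
  [/\ size x + k < 2 ^ s, s <= sp + 1, idx < 2 ^ s &
   [/\ det_outcome s f1 o1, det_outcome s f2 o2 &
   goes (init BM) (cfg None (o1, o2) (Tail M) (tape (fun i => (f1 i, f2 i)) s) 0 idx 0 0)]].
Proof.
have [s [s0 sS lS go]] := init_phase.
have [|s' [idx' [f1 [o1 [ss' s'sp idx'sp out1 go1]]]]] :=
  @det_phase true (None, None) (fun i => (enc (det true 0) 0 i, enc (det false 0) 0 i)) s 0 s0 sS.
  by rewrite expn_gt0.
have [|s2 [idx2 [f2 [o2 [ss2 s2S idx2S out2 go2]]]]] :=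
  @det_phase false (o1, None) (fun i => (f1 i, enc (det false 0) 0 i)) s' idx' _ s'sp idx'sp.
  by lia.
have lS2 : 2 ^ s <= 2 ^ s2 by rewrite leq_exp2l //; lia.
exists s2, idx2, f1, f2, o1, o2; split=> //; first by lia.
split=> //.
  move: out1; rewrite /det_outcome; case: (o1) => // q [n [h1 h2 h3 h4 h5]].
  by exists n; split=> //; apply: within_le h4.
exact: goes_trans go (goes_trans go1 go2).
Qed.

End Run.

(** * The nondeterministic part *)

Lemma runS (N : machine) x k c n : run N x k c n.+1 = step x k c (run N x k c n).
Proof. by []. Qed.

(** A transition sees only the scanned choice cell. This allows an exchange of choice tapes: with
    the zero tape before the first nondeterministic step, and with the decoded word for a run on its
    blocks. *)
Lemma run_local (N : machine) x k c c' n :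
  (forall m, m < n -> chread c (cch (run N x k c m)) = chread c' (cch (run N x k c m))) ->
  run N x k c n = run N x k c' n.
Proof.
elim: n => // n IH H; rewrite !runS -IH; last by move=> m mn; apply: H; lia.
by rewrite /step (H n).
Qed.

Lemma run_halted (N : machine) x k c n m :
  mhalt (cq (run N x k c n)) -> n <= m -> run N x k c m = run N x k c n.
Proof.
move=> h nm; rewrite -(subnK nm); elim: (m - n) => // d IH.
by rewrite addSn runS IH /step h.
Qed.

Lemma step_le (N : machine) x k c (r : config N) (r' := step x k c r) :
  [/\ cwh r' <= (cwh r).+1, cih r' <= (cih r).+1 & cch r' <= (cch r).+1].
Proof.
rewrite /r' /step; case: ifP => // _; case: mdelta => [[[[[q a] dw] b] di] dc] /=.
by rewrite !mv_le.
Qed.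

Section Live.
Variables (M : bool -> machine) (isprod : bool).
Variables (x : seq bool) (k : nat) (cc : nat -> bool).
Variables (sp Bc : nat) (ro : Prop).

Notation BM := (combined M isprod).
Notation stp := (@step BM x k cc).
Notation ok := (@ok M isprod x k cc sp Bc ro).
Notation cfg := (@cfg M isprod).
Notation det j n := (run (M j) x k (fun=> false) n).

Definition gle T a b := exists2 n, n <= T & reach stp ok n a b.

Lemma gle_trans T1 T2 a b c : gle T1 a b -> gle T2 b c -> gle (T1 + T2) a c.
Proof. by move=> [m mT ab] [n nT bc]; exists (m + n); [lia|apply: reach_trans ab bc]. Qed.

Lemma gle_reach n a b : reach stp ok n a b -> gle n a b.
Proof. by exists n. Qed.

Lemma gle_le T T' a b : T <= T' -> gle T a b -> gle T' a b.
Proof. by move=> h [n nT r]; exists n => //; lia. Qed.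

Hypothesis space : forall j c n, cwh (run (M j) x k c n) <= sp /\ cih (run (M j) x k c n) <= sp.
Hypothesis once : ro -> forall j, read_once (M j).

Lemma idx_bound j c n : cidx (run (M j) x k c n) < 2 ^ (sp + 1).
Proof.
elim: n => [|n IH]; first by rewrite /= expn_gt0.
rewrite runS /step; case: ifP => // _; case: mdelta => [[[[[q a] dw] b] di] dc] /=.
by apply: setbit_ltn => //; have [_] := space j c n; lia.
Qed.

Section Track.
Variables (j : bool) (oc : outcomes M) (base s : nat) (U : nat -> track M true * track M false).

(* The choice cells from [base + 1] on are read in blocks of three: a flag for the
   origin of the virtual choice tape, a flag for the last cell used, and a choice bit. *)
Definition origin v := cc (base + 3 * v).
Definition last_flag v := cc (base + 3 * v + 1).
Definition vbit v := cc (base + 3 * v + 2).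
(** Block 0 stands for the left-end cell, which carries no choice; cell [p.+1], where a machine
    reads bit [p], is block [p.+1]. *)
Definition vchoice p := vbit p.+1.

Notation vrun n := (run (M j) x k vchoice n).

(** Only the work symbols are kept up to date in the tail; head marks, index bits and digits remain
    those of the saved track [Y]. *)
Definition ltrack (r : config (M j)) (Y : nat -> track M j) i : track M j :=
  (cwork r i, (Y i).1.1.1.2, (Y i).1.1.2, (Y i).1.2, (Y i).2).

(** A block entered by a left move was checked when it was first entered, hence [true] for [DL]. The
    initial block must also carry the bit 0, so that a path has only one encoding. *)
Lemma read_block (q : mQ (M j)) sn d t wh idx ih v :
  wh <= sp + 4 -> ih <= sp + 4 -> base + 3 * v + 3 <= Bc ->
  let fine := match d with DS => origin v && ~~ vbit v | DR => ~~ origin v | DL => true end in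
  reach stp ok 3 (cfg None oc (Rd0 q sn d) t wh idx ih (base + 3 * v + 1))
    (cfg None oc (if fine then Live q (origin v) (last_flag v) (vbit v) (sn || last_flag v) else Rej M)
       t wh idx ih (base + 3 * v + 3)).
Proof.
move=> wS iS vB fine.
have r1 c : chread c (base + 3 * v + 1) = Some (c (base + 3 * v)) by rewrite addn1.
have r2 c : chread c (base + 3 * v + 2) = Some (c (base + 3 * v + 1)) by rewrite addn2 addn1.
have r3 c : chread c (base + 3 * v + 3) = Some (c (base + 3 * v + 2)) by rewrite addn3 addn2.
have e (b : bool) : (Some b == Some true) = b by case: b.
apply: (@reach_trans _ _ _ 1 2 _ (cfg None oc (Rd1 q sn d (origin v)) t wh idx ih (base + 3 * v + 2))).
  by apply: (@move_step _ _ _ _ _ _ _ _ _ _ _ _ _ _ _ DS (getbit idx ih) DS DR) => //=;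
    rewrite ?r1 ?setbit_getbit //; try (by case: (t wh) => [[? ?] ?] /=; rewrite e); try move=> _; lia.
apply: (@reach_trans _ _ _ 1 1 _ (cfg None oc (Rd2 q sn d (origin v) (last_flag v)) t wh idx ih (base + 3 * v + 3))).
  by apply: (@move_step _ _ _ _ _ _ _ _ _ _ _ _ _ _ _ DS (getbit idx ih) DS DR) => //=;
    rewrite ?r2 ?setbit_getbit //; try (by case: (t wh) => [[? ?] ?] /=; rewrite e); try move=> _; lia.
by apply: (@move_step _ _ _ _ _ _ _ _ _ _ _ _ _ _ _ DS (getbit idx ih) DS DS) => //=;
    rewrite ?r3 ?setbit_getbit //; try (by case: (t wh) => [[? ?] ?] /=; rewrite e); try move=> _; lia.
Qed.

Variables (Y : nat -> track M j).

Definition seen n := has (fun m => last_flag (cch (vrun m))) (iota 0 n.+1).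

Definition live n : config BM :=
  let r := vrun n in
  cfg None oc (Live (cq r) (origin (cch r)) (last_flag (cch r)) (vbit (cch r)) (seen n))
    (tape (upd U (ltrack r Y)) s) (cwh r) (cidx r) (cih r) (base + 3 * cch r + 3).

(** A last flag is excluded strictly to the left of visited blocks: the rightmost visited one may
    carry it. *)
Definition formatted n := forall m, m <= n ->
  (forall u, u < cch (vrun m) -> ~~ last_flag u) /\
  (forall u, u <= cch (vrun m) -> origin u = (u == 0)).

Definition rightful n := cch (vrun n.+1) = (cch (vrun n)).+1 ->
  ~~ last_flag (cch (vrun n)) && ~~ origin (cch (vrun n.+1)).

Hypothesis vbound : forall n, base + 3 * cch (vrun n) + 3 <= Bc.

Lemma seenS n : seen n.+1 = seen n || last_flag (cch (vrun n.+1)).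
Proof. by rewrite /seen -[n.+2]addn1 iotaD has_cat /= orbF. Qed.

Lemma seen_last n : last_flag (cch (vrun n)) -> seen n.
Proof. by case: n => [|n] h; rewrite ?seenS /seen /= ?h ?orbT. Qed.

Lemma formattedS n : formatted n -> rightful n -> formatted n.+1.
Proof.
move=> fn rn m; rewrite leq_eqVlt => /orP[/eqP->|]; last by rewrite ltnS; apply: fn.
have [f1 f2] := fn n (leqnn n).
have [_ _ le1] := step_le x k vchoice (vrun n); rewrite -runS in le1.
have [e|ne] := eqVneq (cch (vrun n.+1)) (cch (vrun n)).+1; last first.
  by split=> u hu; [apply: f1|apply: f2]; lia.
have /andP[h1 h2] := rn e; rewrite e in h2 *; split=> u.
  by rewrite ltnS leq_eqVlt => /orP[/eqP->|] //; apply: f1.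
by rewrite leq_eqVlt => /orP[/eqP->|]; [rewrite (negbTE h2) | rewrite ltnS; apply: f2].
Qed.

(** The flags of visited blocks are truthful, so the simulated machine gets the right choice symbol;
    a wrong flag can only turn up on a move to the right, which is what [rightful] is about. The
    bound 8 is the cost of a left move. *)
Lemma live_step n : formatted n -> ~~ mhalt (cq (vrun n)) ->
  (rightful n -> exists2 t, 0 < t <= 8 & reach stp ok t (live n) (live n.+1)) /\
  (~ rightful n -> exists oc' t wh idx ih ch, gle 4 (live n) (cfg None oc' (Rej M) t wh idx ih ch)).
Proof.
move=> fn nh; have [fl fo] := fn n (leqnn n).
have [wS iS] := space j vchoice n; have := space j vchoice n.+1.
have := vbound n.+1; have := vbound n; have := @seenS n; have := @seen_last n.
have := once; rewrite /read_once => ro'.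
have {ro'} : ro -> cch (vrun n) <= cch (vrun n.+1) by move=> h; apply: ro'.
rewrite /rightful /live; have := runS (M j) x k vchoice n.
move: (vrun n.+1) => r'; move: (vrun n) nh fl fo wS iS => r nh fl fo wS iS.
have rd : chread vchoice (cch r) = if origin (cch r) then None else Some (vbit (cch r)).
  by rewrite fo //; case: (cch r).
rewrite /step (negbTE nh) rd.
case E : mdelta => [[[[[q' a] dw] b] di] dc] r'E ro' sl sS vb vb' [wS' iS'].
have r'q : cq r' = q' by rewrite r'E.
have r'w : cwh r' = mv dw (cwh r) by rewrite r'E.
have r'x : cidx r' = setbit (cidx r) (cih r) b by rewrite r'E.
have r'i : cih r' = mv di (cih r) by rewrite r'E.
have r'c : cch r' = mv dc (cch r) by rewrite r'E.
pose v := cch r; rewrite -/v in rd sl sS vb vb' r'c ro' E fl fo *.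
set t := tape (upd U (ltrack r Y)) s.
pose t' := tape (upd U (ltrack r' Y)) s.
have te : t' = fun i => if i == cwh r then (put (upd U (ltrack r Y) (cwh r)) (ltrack r' Y (cwh r)), cwh r == 0, cwh r < s) else t i.
  by apply: tape_update => // i ne; rewrite /ltrack r'E /= (negbTE ne).
have [c0 c0E] : exists c0, c0 = Live (cq r) (origin v) (last_flag v) (vbit v) (seen n) by eexists.
have nh0 : ~~ halts (None, oc, c0) by rewrite c0E.
pose a' : cell M := (put (upd U (ltrack r Y) (cwh r)) (ltrack r' Y (cwh r)), cwh r == 0, cwh r < s).
rewrite -c0E.
have stepE dc' ch' q2 :
    ctl_delta isprod oc c0 (inp x k (cidx r)) (t (cwh r)) (getbit (cidx r) (cih r)) (chread cc (base + 3 * v + 3)) =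
      ((None, oc, q2), a', dw, b, di, dc') ->
    mv dc' (base + 3 * v + 3) = ch' -> (ro -> base + 3 * v + 3 <= ch') ->
    reach stp ok 1 (cfg None oc c0 t (cwh r) (cidx r) (cih r) (base + 3 * v + 3))
      (cfg None oc q2 t' (cwh r') (cidx r') (cih r') ch').
  move=> de mE rE; apply: (@local_step _ _ _ _ _ _ _ _ _ _ _ _ _ _ _ _ dw b di dc' _ _ _ _ _ nh0 de) => //; lia.
have deltaE :
    ctl_delta isprod oc c0 (inp x k (cidx r)) (t (cwh r)) (getbit (cidx r) (cih r)) (chread cc (base + 3 * v + 3)) =
    match dc with
    | DS => (None, oc, Live q' (origin v) (last_flag v) (vbit v) (seen n), a', dw, b, di, DS)
    | DR => if last_flag v then (None, oc, Rej M, t (cwh r), DS, getbit (cidx r) (cih r), DS, DS)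
            else (None, oc, Rd0 q' (seen n) DR, a', dw, b, di, DR)
    | DL => if origin v then (None, oc, Live q' (origin v) (last_flag v) (vbit v) (seen n), a', dw, b, di, DS)
            else (None, oc, Back q' (seen n) true true, a', dw, b, di, DL)
    end.
  have w' : cwork r' (cwh r) = a by rewrite r'E /= eqxx.
  by rewrite c0E /a' /= /upd getput /ltrack /= w' (negbTE nh) E; case: (dc).
have stay : v = cch r' ->
    ctl_delta isprod oc c0 (inp x k (cidx r)) (t (cwh r)) (getbit (cidx r) (cih r)) (chread cc (base + 3 * v + 3)) =
      ((None, oc, Live q' (origin v) (last_flag v) (vbit v) (seen n)), a', dw, b, di, DS) ->
    exists2 t0, 0 < t0 <= 8 & reach stp ok t0
     (cfg None oc c0 t (cwh r) (cidx r) (cih r) (base + 3 * v + 3))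
     (cfg None oc (Live (cq r') (origin (cch r')) (last_flag (cch r')) (vbit (cch r')) (seen n.+1)) t' (cwh r') (cidx r') (cih r') (base + 3 * cch r' + 3)).
  move=> ve H; exists 1 => //; rewrite sS -ve r'q.
  have -> : seen n || last_flag v = seen n by case: last_flag sl => //= [->|_] //; rewrite orbF.
  exact: stepE H _ _.
clear c0E; case: dc E deltaE r'c {r'E} => E deltaE r'c.
- split=> [_|[]]; last by rewrite r'c /=; lia.
  have [v0|v0] := eqVneq v 0.
    by apply: stay; [rewrite r'c v0 | rewrite deltaE fo // v0].
  rewrite [X in if X then _ else _]fo // (negbTE v0) in deltaE.
  have [u vu] : exists u, v = u.+1 by case: (v) v0 => // u; exists u.
  have r'u : cch r' = u by rewrite r'c vu.
  (* From the third cell of block [u.+1] it takes five moves to the first cell of block [u], one in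
     the simulated step and four in [Back]; then three cells are read. *)
  exists (1 + (4 + 3)) => //.
  have nro : ro -> False by move=> /ro'; rewrite r'u vu; lia.
  apply: reach_trans.
    by apply: (stepE _ (base + 3 * v + 2) _ deltaE); [move=> /=; lia|move=> /nro].
  rewrite r'u r'q; apply: (@reach_trans _ _ _ 4 3 _
     (cfg None oc (Rd0 q' (seen n) DL) t' (cwh r') (cidx r') (cih r') (base + 3 * u + 1))); last first.
    by rewrite sS r'u; apply: (@read_block q' (seen n) DL); lia.
  have back (c c' : ctl M) ch : ~~ halts (None, oc, c) ->
      (forall s a ib b, ctl_delta isprod oc c s a ib b = ((None, oc, c'), a, DS, ib, DS, DL)) ->
      ch.+1 <= base + 3 * v + 3 ->
      reach stp ok 1 (cfg None oc c t' (cwh r') (cidx r') (cih r') ch.+1)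
        (cfg None oc c' t' (cwh r') (cidx r') (cih r') ch).
    move=> nhc de chv.
    by apply: (move_step nhc (de _ _ _ _)) => //; rewrite ?setbit_getbit //; try move=> /nro; lia.
  have -> : base + 3 * v + 2 = (base + 3 * u + 1).+4 by lia.
  have deltaB sn b1 b0 sy (a0 : cell M) ib ch : ctl_delta isprod oc (Back q' sn b1 b0) sy a0 ib ch =
      ((None, oc, match b1, b0 with
           | true, true => Back q' sn true false
           | true, false => Back q' sn false true
           | false, true => Back q' sn false false
           | false, false => Rd0 q' sn DL
           end), a0, DS, ib, DS, DL) by case: a0 => [[? ?] ?].
  rewrite -[4]/(1 + (1 + (1 + 1))).
  apply: (reach_trans (back _ (Back q' (seen n) true false) _ _ (deltaB _ true true) _)) => //; first by lia.
  apply: (reach_trans (back _ (Back q' (seen n) false true) _ _ (deltaB _ true false) _)) => //; first by lia.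
  apply: (reach_trans (back _ (Back q' (seen n) false false) _ _ (deltaB _ false true) _)) => //; first by lia.
  by apply: back (deltaB _ false false) _ => //; lia.
- split=> [_|[]]; last by rewrite r'c /=; lia.
  by apply: stay; [rewrite r'c | rewrite deltaE].
- rewrite [mv _ _]/= in r'c; case: ifP deltaE => lv deltaE.
    split=> [/(_ r'c)|_] //.
    exists oc, t, (cwh r), (cidx r), (cih r), (base + 3 * v + 3).
    apply: (@gle_le 1) => //; apply: gle_reach; apply: (move_step nh0 deltaE) => //; rewrite ?setbit_getbit //; lia.
  have go1 : reach stp ok 1 (cfg None oc c0 t (cwh r) (cidx r) (cih r) (base + 3 * v + 3))
     (cfg None oc (Rd0 q' (seen n) DR) t' (cwh r') (cidx r') (cih r') (base + 3 * v.+1 + 1)).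
    by apply: (stepE _ _ _ deltaE) => //=; lia.
  have w4 : cwh r' <= sp + 4 by clear -wS'; lia.
  have i4 : cih r' <= sp + 4 by clear -iS'; lia.
  have v4 : base + 3 * v.+1 + 3 <= Bc by rewrite -r'c.
  have go4 := reach_trans go1 (@read_block q' (seen n) DR t' _ (cidx r') _ v.+1 w4 i4 v4).
  split=> [/(_ r'c)|rf].
    rewrite r'c => /negbTE no; exists 4 => //; rewrite sS r'c r'q; rewrite no in go4 *.
    exact: go4.
  have o1 : origin v.+1 by apply/negPn/negP => no; apply: rf => _; rewrite r'c no.
  exists oc, t', (cwh r'), (cidx r'), (cih r'), (base + 3 * v.+1 + 3).
  by rewrite o1 in go4; apply: gle_reach; exact: go4.
Qed.

(** The lower bound [i <= t] serves tails that never halt: they yield arbitrarily long traces of the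
    combined machine. *)
Lemma live_run n i : formatted n ->
  (forall m, n <= m < n + i -> ~~ mhalt (cq (vrun m)) /\ rightful m) ->
  formatted (n + i) /\ exists2 t, i <= t <= 8 * i & reach stp ok t (live n) (live (n + i)).
Proof.
move=> fn; elim: i => [|i IH] H.
  by rewrite addn0; split=> //; exists 0 => //; apply: reach0.
have [|fi [t ti rt]] := IH; first by move=> m mi; apply: H; lia.
have [|nh rf] := H (n + i); first by lia.
have [/(_ rf)[t' t'i rt'] _] := live_step fi nh; rewrite addnS.
split; first exact: formattedS.
by exists (t + t'); [lia | apply: reach_trans rt rt'].
Qed.

(** A machine with two-way access may halt to the left of its rightmost block; the head then walks
    to the block flagged as last, with one step to enter each block and three to read it. *)
Lemma advance (q : mQ (M j)) t wh idx ih v d :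
  mhalt q -> macc q -> wh <= sp -> ih <= sp -> base + 3 * (v + d) + 3 <= Bc ->
  (forall w, v <= w < v + d -> ~~ last_flag w) ->
  (forall w, v < w <= v + d -> ~~ origin w) ->
  reach stp ok (4 * d) (cfg None oc (Live q (origin v) (last_flag v) (vbit v) true) t wh idx ih (base + 3 * v + 3))
    (cfg None oc (Live q (origin (v + d)) (last_flag (v + d)) (vbit (v + d)) true) t wh idx ih (base + 3 * (v + d) + 3)).
Proof.
move=> hq aq wS iS; elim: d => [|d IH] vB nl no; first by rewrite muln0 addn0; apply: reach0.
rewrite mulnS addnC; apply: reach_trans (IH _ _ _) _; first by lia.
- by move=> w wd; apply: nl; lia.
- by move=> w wd; apply: no; lia.
have ld : last_flag (v + d) = false by apply/negbTE/nl; lia.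
have od : origin (v + d.+1) = false by apply/negbTE/no; lia.
have -> : 4 = 1 + 3 by [].
apply: (@reach_trans _ _ _ 1 3 _ (cfg None oc (Rd0 q true DR) t wh idx ih (base + 3 * (v + d.+1) + 1))).
  apply: (@move_step _ _ _ _ _ _ _ _ _ _ _ _ _ _ _ DS (getbit idx ih) DS DR) => //;
    rewrite ?setbit_getbit //; try move=> _; try lia; try (rewrite [mv _ _]/=; lia).
  by rewrite [LHS]/=; case: (t wh) => [[tr ?] ?] /=; case: (get j tr) => [[[[? ?] ?] ?] ?]; rewrite hq aq ld.
have w4 : wh <= sp + 4 by lia.
have i4 : ih <= sp + 4 by lia.
have := @read_block q true DR t _ idx _ _ w4 i4 vB.
by rewrite od.
Qed.

Lemma live_accept n : formatted n -> mhalt (cq (vrun n)) -> macc (cq (vrun n)) -> seen n ->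
  let r := vrun n in
  exists e, [/\ exists2 m, m <= n & cch (vrun m) = e, last_flag e, forall m, m <= n -> cch (vrun m) <= e &
    gle (4 * e + 1) (live n)
      (@Config BM (if isprod && ~~ j then (Some false, oc, G0 M) else (None, oc, Acc M))
         (tape (upd U (ltrack r Y)) s) (cwh r) (cidx r) (cih r) (base + 3 * e + 3))].
Proof.
move=> fn hn an sn r; have /hasP[m] := sn; rewrite mem_iota add0n ltnS => /andP[_ mn] lm.
(* [formatted] forbids a last flag strictly to the left of a visited block, so the flagged block is
   the rightmost visited one. *)
have vm m' : m' <= n -> cch (vrun m') <= cch (vrun m).
  move=> m'n; rewrite leqNgt; apply: contraL lm => lt.
  by have [f1 _] := fn m' m'n; apply: f1.
exists (cch (vrun m)); split=> //; first by exists m.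
have [wS iS] := space j vchoice n; have vB := vbound m; have vnm := vm n (leqnn n).
move: (cch (vrun m)) lm vm vB vnm (fn m mn) => e le vm vB; rewrite -/r => vnm [fl fo].
apply: gle_trans.
  apply: (@gle_le (4 * (e - cch r))); first by lia.
  apply: gle_reach; rewrite /live sn -/r; apply: (@advance _ _ _ _ _ _ _ hn an wS iS) => //.
  - by lia.
  - by move=> w we; apply: fl; lia.
  - by move=> w we; rewrite fo; lia.
apply: gle_reach; rewrite subnKC //.
apply: (@move_step _ _ _ _ _ _ _ _ _ _ _ _ _ _ _ DS (getbit (cidx r) (cih r)) DS DS) => //;
  rewrite ?setbit_getbit //; try move=> _; try lia.
rewrite [LHS]/= /upd getput /ltrack hn an le.
by case: ifP.
Qed.

Lemma live_reject n : mhalt (cq (vrun n)) -> ~~ (macc (cq (vrun n)) && seen n) ->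
  exists t wh idx ih ch, gle 1 (live n) (cfg None oc (Rej M) t wh idx ih ch).
Proof.
move=> hn nas; have [wS iS] := space j vchoice n; have vB := vbound n; set r := vrun n in wS iS vB *.
exists (tape (upd U (ltrack r Y)) s), (cwh r), (cidx r), (cih r), (base + 3 * cch r + 3).
apply: gle_reach.
apply: (@move_step _ _ _ _ _ _ _ _ _ _ _ _ _ _ _ DS (getbit (cidx r) (cih r)) DS DS) => //;
  rewrite ?setbit_getbit -?/r //; try move=> _; try lia.
by rewrite [LHS]/= /upd getput /ltrack hn (negbTE nas).
Qed.

End Track.

Lemma vrun_det j base n0 : (forall m, m < n0 -> ~~ stops x k (det j m)) ->
  forall m, m <= n0 -> run (M j) x k (vchoice base) m = det j m.
Proof.
move=> ns m mn; apply/esym/run_local => i im.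
by rewrite det_choice0 // => i' ii; apply: ns; lia.
Qed.

(** Both heads walk in step to the mark of the index head; then the work head alone is rewound and
    sent to its own mark. All bits of the old [idx] have to lie in the region, because only those
    are overwritten. *)
Lemma load_phase j oc base s U n0 idx (r := det j n0) (f := enc r n0) :
  s <= sp + 1 -> idx < 2 ^ s -> outcome j oc = Some (cq r) ->
  within s r -> (forall m, m < n0 -> ~~ stops x k (det j m)) -> base + 3 <= Bc ->
  gle (5 * sp + 20) (cfg None oc (Reload M j) (tape (upd U f) s) 0 idx 0 base)
    (if origin base 0 && ~~ vbit base 0 then live oc base s U f n0
     else cfg None oc (Rej M) (tape (upd U f) s) (cwh r) (cidx r) (cih r) (base + 3)).
Proof.
move=> sS ids out [h1 h2 h3 h4] ns bB.
have t0 i : (upd U f i) = put (U i) (cwork r i, i == cwh r, getbit (cidx r) i, i == cih r, dig M j n0 i) by [].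
set t := tape _ _.
apply: (@gle_le (s + (1 + s.+1 + (cih r + (1 + (cih r).+1 + (cwh r + (1 + 3))))))); first by lia.
apply: (@gle_trans _ _ _ (cfg None oc (Reload M j) t s (cidx r) s base)).
  apply: gle_reach.
  pose F i := cfg None oc (Reload M j) t i (putbits (getbit (cidx r)) idx i) i base.
  rewrite (_ : cfg None oc (Reload M j) t s (cidx r) s base = F s); last by rewrite /F putbits_all.
  apply: (@reach_family _ _ _ _ _ _ _ _ F) => i si.
  apply: (@move_step _ _ _ _ _ _ _ _ _ _ _ _ _ _ _ DR (getbit (cidx r) i) DR DS) => //; try move=> _; try lia.
  by rewrite [LHS]/= t0 getput si.
apply: (@gle_trans _ _ _ (cfg None oc (Pidx M j) t 0 (cidx r) 0 base)).
  apply: gle_trans; apply: gle_reach; last by apply: rewind_both => //; lia.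
  apply: (@move_step _ _ _ _ _ _ _ _ _ _ _ _ _ _ _ DS (getbit (cidx r) s) DS DS) => //;
    rewrite ?setbit_getbit //; try move=> _; try lia.
  by rewrite [LHS]/= t0 getput ltnn.
apply: (@gle_trans _ _ _ (cfg None oc (Pidx M j) t (cih r) (cidx r) (cih r) base)).
  apply: gle_reach; apply: seek_both => //; try lia.
  by move=> i ib ir; rewrite [LHS]/= t0 getput ifN //; lia.
apply: (@gle_trans _ _ _ (cfg None oc (Pwork M j) t 0 (cidx r) (cih r) base)).
  apply: gle_trans; apply: gle_reach; last by apply: rewind_work => //; lia.
  apply: (@move_step _ _ _ _ _ _ _ _ _ _ _ _ _ _ _ DS (getbit (cidx r) (cih r)) DS DS) => //;
    rewrite ?setbit_getbit //; try move=> _; try lia.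
  by rewrite [LHS]/= t0 getput eqxx.
apply: (@gle_trans _ _ _ (cfg None oc (Pwork M j) t (cwh r) (cidx r) (cih r) base)).
  apply: gle_reach; apply: seek_work => //; try lia.
  by move=> i ir; rewrite [LHS]/= t0 getput ifN //; lia.
have e0 : base = base + 3 * 0 by rewrite muln0 addn0.
apply: (@gle_trans _ _ _ (cfg None oc (Rd0 (cq r) false DS) t (cwh r) (cidx r) (cih r) (base + 3 * 0 + 1))).
  apply: gle_reach.
  apply: (@move_step _ _ _ _ _ _ _ _ _ _ _ _ _ _ _ DS (getbit (cidx r) (cih r)) DS DR) => //;
    rewrite ?setbit_getbit //; try move=> _; try lia; try (by rewrite -e0 addn1).
  by rewrite [LHS]/= t0 getput eqxx out.
apply: gle_reach.
have w4 : cwh r <= sp + 4 by lia.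
have i4 : cih r <= sp + 4 by lia.
have b4 : base + 3 * 0 + 3 <= Bc by rewrite -e0.
have := @read_block j oc base (cq r) false DS t _ (cidx r) _ 0 w4 i4 b4.
rewrite -[base + 3 * 0 + 3]/(base + 3 * 0 + 3); case: ifP => _; last by rewrite -e0.
have c0 : cch r = 0 by apply: det_choice0.
have -> : live oc base s U f n0 = cfg None oc (Live (cq r) (origin base 0) (last_flag base 0) (vbit base 0) (false || last_flag base 0)) t (cwh r) (cidx r) (cih r) (base + 3 * 0 + 3); last by [].
rewrite /live (vrun_det base ns (leqnn n0)) -/r c0; congr (cfg _ _ _ _ _ _ _ _).
have -> : seen j base n0 = last_flag base 0; last by [].
have c0' m : m <= n0 -> cch (run (M j) x k (vchoice base) m) = 0.
  by move=> mn; rewrite (vrun_det base ns mn) det_choice0 // => i im; apply: ns; lia.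
apply/hasP/idP => [[m]|l0]; last by exists 0.
by rewrite mem_iota add0n ltnS => /andP[_ mn]; rewrite c0'.
Qed.

(* Writing 1 here and 0 one cell to the left, then reading back, tells whether the
   left move had any effect, provided that the cell to the right contains 0. *)
Lemma leftward_step oc t p idx ch :
  p <= sp -> getbit idx p.+1 = false -> ch <= Bc ->
  gle 3 (cfg None oc (Ga M) t 0 idx p ch)
    (cfg None oc (if 0 < p then Ga M else Z M) t 0
       (setbit (setbit (setbit idx p true) p.-1 false) p.-1.+1 false) p.-1 ch).
Proof.
move=> pS b1 cB; set i1 := setbit idx p true; set i2 := setbit i1 _ _.
have e p' c c' bb d i p1 : p' <= sp + 4 -> mv d p' = p1 -> ~~ halts (None, oc, c) ->
    (forall s a, ctl_delta isprod oc c s a (getbit i p') (chread cc ch) = ((None, oc, c'), a, DS, bb, d, DS)) ->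
    gle 1 (cfg None oc c t 0 i p' ch) (cfg None oc c' t 0 (setbit i p' bb) p1 ch).
  move=> pp mE nh de; apply: gle_reach.
  by apply: (@move_step _ _ _ _ _ _ _ _ _ _ _ _ _ _ _ DS bb d DS) => //; apply: de.
apply: (@gle_trans 1 2 _ (cfg None oc (Gb M) t 0 i1 p.-1 ch)).
  by apply: (e _ _ _ _ DL) => //; [lia | move=> s [[? ?] ?]].
apply: (@gle_trans 1 1 _ (cfg None oc (Gc M) t 0 i2 p.-1.+1 ch)).
  by apply: (e _ _ _ _ DR) => //; [lia | move=> s [[? ?] ?]].
apply: (e _ _ _ _ DL) => //; first by lia.
have -> : getbit i2 p.-1.+1 = (0 < p).
  by rewrite !getbit_setbit; case: (p) b1 => [|p'] /= b1; rewrite ?b1 // eqxx ifN //; lia.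
by move=> s [[? ?] ?].
Qed.

Lemma leftward oc t p idx ch :
  p <= sp -> getbit idx p.+1 = false -> idx < 2 ^ (sp + 2) -> ch <= Bc ->
  exists2 idx', idx' < 2 ^ (sp + 2) &
  gle (3 * p.+1) (cfg None oc (Ga M) t 0 idx p ch) (cfg None oc (Z M) t 0 idx' 0 ch).
Proof.
move=> + + + cB; elim: p idx => [|p IH] idx pS b1 ids; have := leftward_step oc t pS b1 cB; set i3 := setbit _ _ false => st.
  by exists i3 => //; do 3 (apply: setbit_ltn; last by lia).
have [|||i4 i4S go] := IH i3 => //; first by lia.
- by rewrite getbit_setbit eqxx.
- by do 3 (apply: setbit_ltn; last by rewrite /=; lia).
by exists i4 => //; rewrite mulnS; apply: gle_trans st go.
Qed.

(* A nonzero index without bits in the region exceeds [|x| + k], hence reads as blank: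
   this tells when the rest of the index tape is clear. *)
Lemma zero_sweep oc T s idx ch :
  s <= sp + 1 -> size x + k < 2 ^ s -> idx < 2 ^ (sp + 2) -> ch <= Bc ->
  gle (2 * sp + 8) (cfg None oc (Z M) (tape T s) 0 idx 0 ch) (cfg None oc (Reload M true) (tape T s) 0 0 0 ch).
Proof.
move=> sS xs ids cB.
pose F i := cfg None oc (Z M) (tape T s) i (putbits xpred0 idx i) i ch.
pose P e := (s <= e) && ~~ (size x + k < putbits xpred0 idx e).
have zero e : P e -> putbits xpred0 idx e = 0.
  move=> /andP[se]; rewrite -leqNgt => le; apply: getbit_inj => i; rewrite getbit0n.
  case: (ltnP i e) => ie; first by rewrite getbit_putbits ie.
  by apply: (@getbit_small _ _ s); [lia | lia].
have ex : exists e, P e.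
  exists (sp + 2); rewrite /P; apply/andP; split; first by lia.
  rewrite (_ : putbits _ _ _ = 0) //; apply: getbit_inj => i; rewrite getbit0n getbit_putbits.
  by case: ltnP => // h; rewrite (getbit_small ids).
case: (ex_minnP ex) => e Pe emin; have eS : e <= sp + 2.
  apply: emin; rewrite /P; apply/andP; split; first by lia.
  rewrite (_ : putbits _ _ _ = 0) //; apply: getbit_inj => i; rewrite getbit0n getbit_putbits.
  by case: ltnP => // h; rewrite (getbit_small ids).
apply: (@gle_le (e + (1 + e.+1))); first by lia.
apply: (@gle_trans _ _ _ (F e)).
  apply: gle_reach; apply: (@reach_family _ _ _ _ _ _ _ _ F) => i ie.
  apply: (@move_step _ _ _ _ _ _ _ _ _ _ _ _ _ _ _ DR false DR DS) => //; try move=> _; try lia.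
  rewrite [LHS]/= is_blank_inp ifT //; case: ltnP => //= si.
  by apply/negPn/negP => h; have := emin i; rewrite /P si h => /(_ isT); lia.
rewrite /F (zero _ Pe); apply: (@gle_trans _ _ _ (cfg (Some true) oc (Reload M true) (tape T s) e 0 e ch)).
  apply: gle_reach.
  apply: (@move_step _ _ _ _ _ _ _ _ _ _ _ _ _ _ _ DS (getbit 0 e) DS DS) => //;
    rewrite ?setbit_getbit //; try move=> _; try lia.
  rewrite [LHS]/= is_blank_inp ltn0 ifN //.
  by move: Pe => /andP[h _]; rewrite orbF -leqNgt.
by apply: gle_reach; apply: rewind_both => //; lia.
Qed.

(** It connects the two tails of a product, making the index tape fit for reloading. [G0] and [G1]
    provide the 0 to the right of the index head on which the search for the left end relies. *)
Lemma clear_phase oc T s wh idx ih ch :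
  s <= sp + 1 -> size x + k < 2 ^ s -> idx < 2 ^ (sp + 1) -> wh <= sp -> ih <= sp -> ch <= Bc ->
  gle (6 * sp + 20) (cfg (Some false) oc (G0 M) (tape T s) wh idx ih ch)
    (cfg None oc (Reload M true) (tape T s) 0 0 0 ch).
Proof.
move=> sS xs ids wS iS cB.
set i1 := setbit idx ih.+1 false.
have i1S : i1 < 2 ^ (sp + 2).
  apply: setbit_ltn; last by lia.
  by apply: leq_trans ids _; rewrite leq_exp2l //; lia.
have [|i2 i2S go] := @leftward oc (tape T s) ih i1 ch iS _ i1S cB; first by rewrite getbit_setbit eqxx.
apply: (@gle_le (wh.+1 + (1 + (1 + (3 * ih.+1 + (2 * sp + 8)))))); first by lia.
apply: (@gle_trans _ _ _ (cfg None oc (G0 M) (tape T s) 0 idx ih ch)).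
  by apply: gle_reach; apply: rewind_work => //; lia.
apply: (@gle_trans _ _ _ (cfg None oc (G1 M) (tape T s) 0 idx ih.+1 ch)).
  apply: gle_reach.
  by apply: (@move_step _ _ _ _ _ _ _ _ _ _ _ _ _ _ _ DS (getbit idx ih) DR DS) => //;
    rewrite ?setbit_getbit //; try move=> _; lia.
apply: (@gle_trans _ _ _ (cfg None oc (Ga M) (tape T s) 0 i1 ih ch)).
  apply: gle_reach.
  by apply: (@move_step _ _ _ _ _ _ _ _ _ _ _ _ _ _ _ DS false DL DS) => //;
    try move=> _; lia.
by apply: gle_trans go _; apply: zero_sweep.
Qed.

End Live.

(** * Counting accepting paths *)

(** Block [v] has its bits at [3 * v], [3 * v + 1] and [3 * v + 2]. In [false :: w] the word is
    shifted: block 0 gets the fixed bit 0, block [v.+1] the bit [v] of [w]. *)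
Definition code (w : seq bool) i : bool :=
  let v := i %/ 3 in nth false [:: v == 0; v == size w; nth false (false :: w) v] (i %% 3).

Definition codeword w := mkseq (code w) (3 * (size w).+1).

Lemma size_codeword w : size (codeword w) = 3 * (size w).+1.
Proof. exact: size_mkseq. Qed.

Lemma nth_codeword w i : i < 3 * (size w).+1 -> nth false (codeword w) i = code w i.
Proof. exact: nth_mkseq. Qed.

Definition coded (cc : nat -> bool) base w :=
  forall i, i < 3 * (size w).+1 -> cc (base + i) = code w i.

Lemma coded_block cc base w : coded cc base w -> forall v, v <= size w ->
  [/\ origin cc base v = (v == 0), last_flag cc base v = (v == size w) &
      vbit cc base v = nth false (false :: w) v].
Proof.
move=> cw v vw; rewrite /origin /last_flag /vbit -(addnA base _ 1) -(addnA base _ 2) !cw; try lia.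
rewrite /code; have d r : r < 3 -> (3 * v + r) %/ 3 = v /\ (3 * v + r) %% 3 = r by lia.
have [d1 m1] := d 1 isT; have [d2 m2] := d 2 isT; have := d 0 isT; rewrite addn0 => -[d0 m0].
by rewrite d0 m0 d1 m1 d2 m2.
Qed.

Lemma codedP cc base w :
  (forall v, v <= size w -> [/\ origin cc base v = (v == 0), last_flag cc base v = (v == size w) &
      vbit cc base v = nth false (false :: w) v]) -> coded cc base w.
Proof.
move=> H i iw; have vw : i %/ 3 <= size w by lia.
have [h0 h1 h2] := H _ vw; rewrite /origin /last_flag /vbit in h0 h1 h2.
rewrite /code; have := ltn_pmod i (isT : 0 < 3); have e := divn_eq i 3; rewrite mulnC in e.
case: (i %% 3) e => [|[|[|]]] // {1}-> _.
- by rewrite addn0 h0.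
- by rewrite (addnA base _ 1) h1.
- by rewrite (addnA base _ 2) h2.
Qed.

(** The first block flagged as last fixes the length, and then the choice bits fix the word. This is
    the prefix property of the code. *)
Lemma coded_inj cc base w w' : coded cc base w -> coded cc base w' -> w = w'.
Proof.
move=> /coded_block cw /coded_block cw'.
have ss : size w = size w'.
  have [h|h|//] := ltngtP (size w) (size w').
    have [_ + _] := cw _ (leqnn _); have [_ -> _] := cw' _ (ltnW h); rewrite eqxx => /eqP; lia.
  have [_ + _] := cw' _ (leqnn _); have [_ -> _] := cw _ (ltnW h); rewrite eqxx => /eqP; lia.
apply: (@eq_from_nth _ false) => // i iw.
have [_ _ /= <-] := cw i.+1 iw; have [|_ _ /= <- //] := cw' i.+1; by rewrite -ss.
Qed.

Definition is_prefix (cc : nat -> bool) (W : seq bool) := forall i, i < size W -> cc i = nth false W i.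

Lemma is_prefix_cat cc w2 w1 : is_prefix cc (codeword w2 ++ codeword w1) <->
  coded cc 0 w2 /\ coded cc (0 + 3 * size w2 + 3) w1.
Proof.
rewrite /is_prefix size_cat !size_codeword; have -> : 0 + 3 * size w2 + 3 = 3 * (size w2).+1 by lia.
split=> [H|[c2 c1] i ii].
  split=> i iw; rewrite H ?nth_cat ?size_codeword; try lia.
    by rewrite add0n ifT // nth_codeword.
  by rewrite ifN ?addKn ?nth_codeword //; lia.
rewrite nth_cat size_codeword; case: ltnP => iw; first by rewrite nth_codeword // -c2.
by rewrite nth_codeword -?c1; [congr cc|..]; lia.
Qed.

Lemma is_prefix_cons cc b w : is_prefix cc (b :: codeword w) <-> cc 0 = b /\ coded cc 1 w.
Proof.
rewrite /is_prefix; have -> : size (b :: codeword w) = (3 * (size w).+1).+1 by rewrite -size_codeword.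
have nthS i : nth false (b :: codeword w) i.+1 = nth false (codeword w) i by [].
split=> [H|[e c]].
  split=> [|i iw]; first by rewrite H.
  by rewrite add1n H // nthS nth_codeword.
by case=> // i; rewrite ltnS => ii; rewrite nthS nth_codeword // -c.
Qed.

(** * Outcome of the tail on a given choice tape *)

Section Result.
Variables (M : bool -> machine) (isprod : bool).
Variables (x : seq bool) (k : nat) (cc : nat -> bool).
Variables (sp Bc : nat) (ro : Prop).

Notation BM := (combined M isprod).
Notation stp := (@step BM x k cc).
Notation cfg := (@cfg M isprod).
Notation det j n := (run (M j) x k (fun=> false) n).
Notation gle := (@gle M isprod x k cc sp Bc ro).
Notation vrun j base n := (run (M j) x k (vchoice cc base) n).

Hypothesis space : forall j c n, cwh (run (M j) x k c n) <= sp /\ cih (run (M j) x k c n) <= sp.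
Hypothesis once : ro -> forall j, read_once (M j).

Lemma coded_run j base w n : acc_path (M j) x k w -> coded cc base w ->
  run (M j) x k (fun i => nth false w i) n = vrun j base n.
Proof.
move=> [N [aN [bN _]]] cw; apply: run_local => m mn.
have : cch (run (M j) x k (fun i => nth false w i) m) <= size w.
  case: (leqP m N) => mN; first exact: bN.
  by rewrite (run_halted (n := N)) //; [apply: bN | case/andP: aN | apply: ltnW].
case: (cch _) => //= p pw; congr Some.
by have [_ _ /= <-] := coded_block cw pw.
Qed.

Lemma coded_accept j base w : acc_path (M j) x k w -> coded cc base w ->
  exists n, [/\ accepting (vrun j base n), exists2 m, m <= n & cch (vrun j base m) = size w &
             forall m, cch (vrun j base m) <= size w].
Proof.
move=> aw cw; have [N [aN [bN [m [mN em]]]]] := aw; exists N; split.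
- by rewrite -(coded_run N aw cw).
- by exists m => //; rewrite -(coded_run m aw cw).
move=> m'; rewrite -(coded_run m' aw cw).
case: (leqP m' N) => m'N; first exact: bN.
by rewrite (run_halted (n := N)) //; [apply: bN | case/andP: aN | apply: ltnW].
Qed.

(** The word is read off the choice bits of blocks 1 to [e]. The run up to [n] depends on no others,
    and it visits block [e], so it reads exactly this word. *)
Lemma accept_coded j base n e : accepting (vrun j base n) ->
  (exists2 m, m <= n & cch (vrun j base m) = e) -> (forall m, m <= n -> cch (vrun j base m) <= e) ->
  formatted M x k cc j base n -> last_flag cc base e -> ~~ vbit cc base 0 ->
  exists w, [/\ size w = e, acc_path (M j) x k w & coded cc base w].
Proof.
move=> an [m mn em] be fn le b0; pose w := mkseq (vchoice cc base) e.
have sw : size w = e by rewrite size_mkseq.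
have rE i : i <= n -> run (M j) x k (fun i => nth false w i) i = vrun j base i.
  move=> i_n; apply/esym/run_local => i' ii'.
  have := be i' _; case: (cch _) => //= p pe; congr Some; rewrite nth_mkseq //; apply: pe; lia.
exists w; split=> //.
  exists n; rewrite rE //; split=> //; split; first by move=> m' m'n; rewrite rE // sw be.
  by exists m; rewrite rE // sw.
have [nl ol] := fn m mn; rewrite em in nl ol.
apply: codedP => v; rewrite sw => ve; split; first exact: ol.
  by move: ve; rewrite leq_eqVlt => /orP[/eqP->|ve]; [rewrite le eqxx | rewrite (negbTE (nl _ ve)) (ltn_eqF ve)].
by case: v ve => [|p] pe; [apply/negbTE | rewrite /= nth_mkseq].
Qed.

(* [I] bounds the number of simulated steps of a tail; with [None], a tail need not halt
   and no running time is claimed. *)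
Variable I : option nat.

Definition gleI (T : nat -> nat) a b := if I is Some i then gle (T i) a b else exists t, gle t a b.

Lemma gleI_trans T1 T2 a b c : gleI T1 a b -> gleI T2 b c -> gleI (fun i => T1 i + T2 i) a c.
Proof.
rewrite /gleI; case: I => [i|]; first exact: gle_trans.
by move=> [t ab] [t' bc]; exists (t + t'); apply: gle_trans ab bc.
Qed.

Lemma gleI_le T1 T2 a b : (forall i, T1 i <= T2 i) -> gleI T1 a b -> gleI T2 a b.
Proof. by rewrite /gleI; case: I => // i le; apply: gle_le. Qed.

Lemma gleI_gle T t a b : (forall i, I = Some i -> t <= T i) -> gle t a b -> gleI T a b.
Proof.
rewrite /gleI; case: I => [i|] H ab; last by exists t.
exact: gle_le (H i erefl) ab.
Qed.

Definition runs_forever a := I = None /\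
  forall N, exists t, exists2 b : config BM, N < t & reach stp (@ok M isprod x k cc sp Bc ro) t a b /\ ~~ mhalt (cq b).

Definition rejects T a := exists oc t wh idx ih ch, gleI T a (cfg None oc (Rej M) t wh idx ih ch).

Lemma gleI_rejects T1 T2 T a b : (forall i, T1 i + T2 i <= T i) -> gleI T1 a b -> rejects T2 b -> rejects T a.
Proof.
move=> le ab [oc [t [wh [idx [ih [ch bc]]]]]]; exists oc, t, wh, idx, ih, ch.
have := gleI_trans ab bc; rewrite /gleI; case: I => // i; apply: gle_le; exact: le.
Qed.

Lemma gleI_forever T a b : gleI T a b -> runs_forever b -> runs_forever a.
Proof.
move=> ab [IN H]; split=> //; move: ab; rewrite /gleI IN => -[t0 [n _ rn]] N.
have [t [c Nt [rc hc]]] := H N; exists (n + t), c; first by lia.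
by split=> //; apply: reach_trans rn rc.
Qed.

Lemma first_failure (P : nat -> Prop) (i : nat) : (forall m, P m \/ ~ P m) ->
  (forall m, m < i -> P m) \/ exists2 d, d < i & (forall m, m < d -> P m) /\ ~ P d.
Proof.
move=> dec; elim: i => [|i [IH|[d di H]]]; first by left.
  case: (dec i) => Pi; last by right; exists i.
  by left=> m; rewrite ltnS leq_eqVlt => /orP[/eqP->|/IH].
by right; exists d => //; apply: ltnW.
Qed.

(** Consider the first simulated step from [n0] on that halts or meets a wrong flag. At a halt, the
    state and [seen] decide; a wrong flag rejects, and a codeword of an accepting path contains
    none. If there is no such step, which can happen only for [I = None], the tail runs forever.
    This case distinction is classical. *)
Lemma session j base oc s U n0 idx (f := enc (det j n0) n0) :
  s <= sp + 1 -> idx < 2 ^ s -> outcome j oc = Some (cq (det j n0)) ->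
  within s (det j n0) -> (forall m, m < n0 -> ~~ stops x k (det j m)) ->
  (forall n, base + 3 * cch (vrun j base n) + 3 <= Bc) ->
  (forall i, I = Some i -> mhalt (cq (vrun j base (n0 + i)))) ->
  let start := cfg None oc (Reload M j) (tape (upd U f) s) 0 idx 0 base in
  let T i := 5 * sp + 30 + 8 * i + 4 * Bc in
  (exists w (r : config (M j)), [/\ acc_path (M j) x k w, coded cc base w,
     cwh r <= sp /\ cih r <= sp, cidx r < 2 ^ (sp + 1) & base + 3 * size w + 3 <= Bc /\
     gleI T start (@Config BM (if isprod && ~~ j then (Some false, oc, G0 M) else (None, oc, Acc M))
       (tape (upd U (ltrack r f)) s) (cwh r) (cidx r) (cih r) (base + 3 * size w + 3))]) \/
  (forall w, acc_path (M j) x k w -> ~ coded cc base w) /\ (rejects T start \/ runs_forever start).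
Proof.
move=> sS ids out wr ns bB halt start T; set R := (_ \/ _).
have b0 : base + 3 <= Bc by apply: leq_trans (bB 0); lia.
have := @load_phase M isprod x k cc sp Bc ro j oc base s U n0 idx sS ids out wr ns b0.
rewrite -/f -/start; case: ifP => [/andP[o0 nb0]|bad] load; last first.
  right; split=> [w _ /coded_block/(_ 0 isT)[o0 _ v0]|]; first by rewrite o0 v0 in bad.
  left; do 6 eexists; apply: gleI_gle load; rewrite /T; lia.
pose r n := vrun j base n.
have c0 m : m <= n0 -> cch (r m) = 0.
  move=> mn; rewrite /r (vrun_det cc base ns mn) det_choice0 // => i im; apply: ns; lia.
have f0 : formatted M x k cc j base n0.
  by move=> m mn; rewrite -/(r m) c0 //; split=> // -[].
pose good m := ~~ mhalt (cq (r (n0 + m))) /\ rightful M x k cc j base (n0 + m).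
have good_dec m : good m \/ ~ good m by apply: classic.
have acc_good w : acc_path (M j) x k w -> coded cc base w -> forall n, rightful M x k cc j base n.
  move=> aw cw n e; have [N [_ _ le]] := coded_accept aw cw.
  have := le n.+1; rewrite e => le'; have [_ -> _] := coded_block cw (ltnW le').
  by have [-> _ _] := coded_block cw le'; rewrite (ltn_eqF le').
have finish d : (forall m, m < d -> good m) -> mhalt (cq (r (n0 + d))) -> (forall i, I = Some i -> d <= i) -> R.
  move=> gd hd dI; have [|fd [t td go]] := @live_run M isprod x k cc sp Bc ro space once j oc base s U f bB n0 d f0.
    by move=> m /andP[nm md]; have := gd (m - n0); rewrite /good subnKC //; apply; lia.
  have {}go : gle (8 * d) (live isprod x k cc oc base s U f n0) (live isprod x k cc oc base s U f (n0 + d)).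
    by apply: (@gle_le _ _ _ _ _ _ _ _ t); [lia | apply: gle_reach].
  have [/andP[ad sd]|nas] := boolP (macc (cq (r (n0 + d))) && seen M x k cc j base (n0 + d)).
    have [e [em le lm go2]] := @live_accept M isprod x k cc sp Bc ro space j oc base s U f bB _ fd hd ad sd.
    left; have [|w [sw aw cw]] := accept_coded _ em lm fd le nb0; first by rewrite /accepting hd.
    exists w, (r (n0 + d)); rewrite sw; split=> //; first exact: space.
      exact: idx_bound.
    have eB : base + 3 * e + 3 <= Bc by have [m _ <-] := em.
    split=> //; apply: gleI_gle (gle_trans load (gle_trans go go2)).
    by move=> i /dI; rewrite /T; lia.
  right; split.
    move=> w aw cw; have [N [aN [m mN em] le]] := coded_accept aw cw.
    (* A halted run is constant, so the configuration accepting [w] would be the present one, and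
       the flag of block [size w] would have been seen. *)
    have rN : r N = r (n0 + d).
      case: (leqP N (n0 + d)) => h; last by rewrite /r (run_halted hd) // ltnW.
      by rewrite /r (run_halted _ h) //; case/andP: aN.
    case/negP: nas; rewrite -rN; apply/andP; split; first by case/andP: aN.
    apply/hasP; case: (leqP m (n0 + d)) => h.
      exists m; first by rewrite mem_iota add0n ltnS.
      by rewrite em; have [_ -> _] := coded_block cw (leqnn _); rewrite eqxx.
    exists (n0 + d); first by rewrite mem_iota add0n ltnS leqnn.
    have e : r m = r (n0 + d) by rewrite /r (run_halted hd) // ltnW.
    by rewrite -/(r (n0 + d)) -e em; have [_ -> _] := coded_block cw (leqnn _); rewrite eqxx.
  left; have [t' [wh [ix [ih [ch go2]]]]] := @live_reject M isprod x k cc sp Bc ro space j oc base s U f bB _ hd nas.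
  do 6 eexists; apply: gleI_gle (gle_trans load (gle_trans go go2)).
  by move=> i /dI; rewrite /T; lia.
have wrong d : (forall m, m < d -> good m) -> ~ good d -> (forall i, I = Some i -> d <= i) -> R.
  move=> gd ngd dI; have [hd|nhd] := boolP (mhalt (cq (r (n0 + d)))); first exact: finish hd dI.
  have [|fd [t td go]] := @live_run M isprod x k cc sp Bc ro space once j oc base s U f bB n0 d f0.
    by move=> m /andP[nm md]; have := gd (m - n0); rewrite /good subnKC //; apply; lia.
  have nr : ~ rightful M x k cc j base (n0 + d) by move=> h; apply: ngd.
  right; split; first by move=> w aw cw; apply/nr/acc_good/cw.
  have {}go : gle (8 * d) (live isprod x k cc oc base s U f n0) (live isprod x k cc oc base s U f (n0 + d)).
    by apply: (@gle_le _ _ _ _ _ _ _ _ t); [lia | apply: gle_reach].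
  have [_ /(_ nr)[oc' [t' [wh [ix [ih [ch go2]]]]]]] := @live_step M isprod x k cc sp Bc ro space once j oc base s U f bB _ fd nhd.
  left; do 6 eexists; apply: gleI_gle (gle_trans load (gle_trans go go2)).
  by move=> i /dI; rewrite /T; lia.
case IE : I (halt) => [i|] h; last first.
  have [[d ngd]|allgood] := classic (exists d, ~ good d).
    have [gd|[d' d'd [gd' ngd']]] := first_failure d good_dec; [apply: (wrong d)|apply: (wrong d')] => //;
      by rewrite IE.
  have ag m : good m by have [//|ng] := good_dec m; case: allgood; exists m.
  right; split.
    move=> w aw cw; have [N [aN _ _]] := coded_accept aw cw.
    have [/negP[]] := ag N; rewrite /r (run_halted (n := N)) ?leq_addl //; by case/andP: aN.
  right; split=> // N; have [t0 t0le rt0] := load.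
  have [|fN [t /andP[Nt _] go]] := @live_run M isprod x k cc sp Bc ro space once j oc base s U f bB n0 N.+1 f0.
    by move=> m /andP[nm md]; have := ag (m - n0); rewrite /good subnKC.
  exists (t0 + t), (live isprod x k cc oc base s U f (n0 + N.+1)); first by lia.
  by split=> //; apply: reach_trans rt0 go.
have {}h := h i erefl.
have [gd|[d di [gd ngd]]] := first_failure i good_dec.
  by apply: (finish i) => // i'; rewrite IE => -[->].
by apply: (wrong d) => // i'; rewrite IE => -[<-]; apply: ltnW.
Qed.

Definition good_word (W : seq bool) : Prop :=
  if isprod then exists w2 w1, [/\ W = codeword w2 ++ codeword w1, acc_path (M false) x k w2 &
                                 acc_path (M true) x k w1]
  else exists b w, W = b :: codeword w /\ acc_path (M b) x k w.

Lemma good_word_prod W : isprod -> good_word W <-> exists w2 w1,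
  [/\ W = codeword w2 ++ codeword w1, acc_path (M false) x k w2 & acc_path (M true) x k w1].
Proof. by rewrite /good_word => ->. Qed.

Lemma good_word_sum W : ~~ isprod -> good_word W <-> exists b w, W = b :: codeword w /\ acc_path (M b) x k w.
Proof. by rewrite /good_word => /negbTE->. Qed.

(** Without a first nondeterministic step the run is the same on every choice tape, and it never
    halts. *)
Lemma never_stops_no_acc j : (forall m, ~~ stops x k (det j m)) -> forall w, ~ acc_path (M j) x k w.
Proof.
move=> ns w [n [an _]]; case/negP: (ns n); rewrite /stops.
rewrite (_ : det j n = run (M j) x k (fun i => nth false w i) n); first by case/andP: an => ->.
by apply: run_local => m _; rewrite det_choice0.
Qed.

Hypothesis halting : forall i, I = Some i -> forall j base n0, stops x k (det j n0) ->
  (forall m, m < n0 -> ~~ stops x k (det j m)) -> mhalt (cq (vrun j base (n0 + i))).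

Lemma tail_step oc (c : ctl M) t idx ch ch' dc :
  ctl_delta isprod oc (Tail M) (inp x k idx) (t 0) (getbit idx 0) (chread cc ch) =
    ((None, oc, c), t 0, DS, getbit idx 0, DS, dc) -> mv dc ch = ch' -> ch <= Bc -> ch <= ch' ->
  gle 1 (cfg None oc (Tail M) t 0 idx 0 ch) (cfg None oc c t 0 idx 0 ch').
Proof.
move=> de mE cB cc'; apply: gle_reach.
by apply: (@move_step _ _ _ _ _ _ _ _ _ _ _ _ _ _ _ DS (getbit idx 0) DS dc) => //; rewrite setbit_getbit.
Qed.

(** The second tail of a product begins behind the codeword of the path [w] accepted by the first,
    so its choice bound is required only for such [w]. In this form [Bc] can later be the length of
    the accepted word itself. *)
Lemma tail_part s idx f1 f2 o1 o2 :
  s <= sp + 1 -> size x + k < 2 ^ s -> idx < 2 ^ s -> @det_outcome M x k true s f1 o1 -> @det_outcome M x k false s f2 o2 ->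
  (isprod -> (forall n, 0 + 3 * cch (vrun false 0 n) + 3 <= Bc) /\
     (forall w, acc_path (M false) x k w -> coded cc 0 w ->
       forall n, 0 + 3 * size w + 3 + 3 * cch (vrun true (0 + 3 * size w + 3) n) + 3 <= Bc)) ->
  (~~ isprod -> forall n, 1 + 3 * cch (vrun (cc 0) 1 n) + 3 <= Bc) ->
  let start := cfg None (o1, o2) (Tail M) (tape (fun i => (f1 i, f2 i)) s) 0 idx 0 0 in
  let T i := 16 * sp + 100 + 16 * i + 8 * Bc in
  (exists W, [/\ good_word W, is_prefix cc W &
     exists oc t wh ix ih, gleI T start (cfg None oc (Acc M) t wh ix ih (size W))]) \/
  (forall W, good_word W -> ~ is_prefix cc W) /\ (rejects T start \/ runs_forever start).
Proof.
move=> sS xs ids d1 d2 hBp hBs.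
have dead : ~~ (o1 && o2) -> exists j, forall m, ~~ stops x k (det j m).
  move: d1 d2; rewrite /det_outcome; case: (o1) => [?|] => [|ns _ _]; last by exists true.
  by case: (o2) => [?|] // _ ns _; exists false.
move=> start T.
have [E|E] : isprod \/ ~~ isprod by case: (isprod); [left|right].
- have [hB1 hB2] := hBp E.
  have [no|] := boolP (~~ (o1 && o2)).
    right; split.
      move=> W /(good_word_prod _ E)[w2 [w1 [_ a2 a1]]] _.
      by have [[] /never_stops_no_acc ns] := dead no; [apply: ns a1 | apply: ns a2].
    left; do 6 eexists; apply: (@gleI_gle _ 1); first by rewrite /T; lia.
    apply: (tail_step (dc := DS)) => //; rewrite /tape /ctl_delta E.
    by have -> : (o1, o2).1 && (o1, o2).2 = false by apply/negbTE.
  rewrite negbK => both.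
  have go0 : gle 1 start (cfg None (o1, o2) (Reload M false) (tape (fun i => (f1 i, f2 i)) s) 0 idx 0 0).
    apply: (tail_step (dc := DS)) => //; rewrite /tape /ctl_delta E.
    by have -> : (o1, o2).1 && (o1, o2).2 = true by [].
  clear dead; case: o1 o2 both d1 d2 @start go0 => [q1|] [q2|] // _.
  move=> [n1 [e1 st1 ns1 wr1 E1]] [n2 [e2 st2 ns2 wr2 E2]] start go0.
  subst q1 q2 f1 f2; pose g1 := enc (det true n1) n1; pose g2 := enc (det false n2) n2.
  have h2 i : I = Some i -> mhalt (cq (vrun false 0 (n2 + i))) by move=> /halting; apply.
  have := @session false 0 (Some (cq (det true n1)), Some (cq (det false n2))) s (fun i => (g1 i, g2 i)) n2 idx sS ids erefl wr2 ns2 hB1 h2.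
  case=> [[w2 [r [acc2 cod2 [wS iS] xS [eB go1]]]]|[none bad]]; last first.
    right; split; first by move=> W /(good_word_prod _ E)[w2 [w1 [-> a2 _]]] /is_prefix_cat[c2 _]; case: (none _ a2 c2).
    have go0' : gleI (fun=> 1) start _ := gleI_gle (fun _ _ => leqnn 1) go0.
    case: bad => bad; [left; apply: gleI_rejects go0' bad; rewrite /T; lia | right; apply: gleI_forever go0' bad].
  have e1 : isprod && ~~ false by rewrite E.
  rewrite e1 in go1.
  have go2 := @clear_phase M isprod x k cc sp Bc ro (Some (cq (det true n1)), Some (cq (det false n2)))
    (upd (fun i => (g1 i, g2 i)) (ltrack r g2)) s _ _ _ _ sS xs xS wS iS eB.
  pose U' i := (g1 i, ltrack r g2 i).
  set base := 0 + 3 * size w2 + 3 in eB go1 go2.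
  have h1 i : I = Some i -> mhalt (cq (vrun true base (n1 + i))) by move=> /halting; apply.
  have s0 : 0 < 2 ^ s by rewrite expn_gt0.
  have := @session true base (Some (cq (det true n1)), Some (cq (det false n2))) s U' n1 0 sS s0 erefl wr1 ns1 (hB2 _ acc2 cod2) h1.
  have e2 : isprod && ~~ true = false by rewrite andbF.
  rewrite e2.
  have go12 := gleI_trans (gleI_trans (gleI_gle (T := fun=> 1) (fun _ _ => leqnn 1) go0) go1)
                 (gleI_gle (T := fun=> 6 * sp + 20) (fun _ _ => leqnn _) go2).
  case=> [[w1 [r1 [acc1 cod1 _ _ [eB1 go3]]]]|[none bad]]; last first.
    right; split.
      (* By the prefix property, the first factor of any candidate is the [w2] already accepted, so
         the second factor begins at [base]. *)
      move=> W /(good_word_prod _ E)[w2' [w1 [-> a2 a1]]] /is_prefix_cat[c2 c1]; rewrite -(coded_inj cod2 c2) in c1.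
      by case: (none _ a1 c1).
    case: bad => bad; [left; apply: gleI_rejects go12 bad; rewrite /T; lia | right; apply: gleI_forever go12 bad].
  left; exists (codeword w2 ++ codeword w1); split; first by apply/(good_word_prod _ E); exists w2, w1.
    by apply/is_prefix_cat.
  do 5 eexists; rewrite size_cat !size_codeword.
  have -> : 3 * (size w2).+1 + 3 * (size w1).+1 = base + 3 * size w1 + 3 by rewrite /base; lia.
  by apply: gleI_le (gleI_trans go12 go3) => i; rewrite /T; lia.
have hB := hBs E; have B1 : 1 <= Bc by apply: leq_trans (hB 0); lia.
have go0 : gle 1 start (cfg None (o1, o2) (Pick M) (tape (fun i => (f1 i, f2 i)) s) 0 idx 0 1).
  by apply: (tail_step (dc := DR)); rewrite //= E.
have pick : gle 2 start (cfg None (o1, o2) (if outcome (cc 0) (o1, o2) then Reload M (cc 0) else Rej M)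
    (tape (fun i => (f1 i, f2 i)) s) 0 idx 0 1).
  apply: (@gle_trans M isprod x k cc sp Bc ro 1 1) go0 _; apply: gle_reach.
  apply: (@move_step _ _ _ _ _ _ _ _ _ _ _ _ _ _ _ DS (getbit idx 0) DS DS) => //;
    rewrite ?setbit_getbit //.
  by rewrite /=; case: (cc 0).
have pickI : gleI (fun=> 2) start _ := gleI_gle (fun _ _ => leqnn 2) pick.
set R := (_ \/ _).
have main (j : bool) (fj : nat -> track M j) (oj : option (mQ (M j))) U : cc 0 = j ->
  (forall n, 1 + 3 * cch (vrun j 1 n) + 3 <= Bc) ->
  @det_outcome M x k j s fj oj -> oj = outcome j (o1, o2) ->
  gleI (fun=> 2) start (cfg None (o1, o2) (if oj then Reload M j else Rej M) (tape (upd U fj) s) 0 idx 0 1) -> R.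
  move=> cj bj; case: oj => [q|] /=; last first.
    move=> ns _ go; right; split.
      by move=> W /(good_word_sum _ E)[b [w [-> a]]] /is_prefix_cons[]; rewrite cj => jb _; subst b; case: (never_stops_no_acc ns a).
    by left; do 6 eexists; apply: gleI_le go => i; rewrite /T; lia.
  move=> [n [eq st ns wr ->]] out; rewrite eq in out; move=> go.
  have hj i : I = Some i -> mhalt (cq (vrun j 1 (n + i))) by move=> /halting; apply.
  have := @session j 1 (o1, o2) s U n idx sS ids (esym out) wr ns bj hj.
  have e : isprod && ~~ j = false by rewrite (negbTE E).
  rewrite e; case=> [[w [r [acc cod _ _ [eB go3]]]]|[none bad]]; last first.
    right; split.
      by move=> W /(good_word_sum _ E)[b [w [-> a]]] /is_prefix_cons[]; rewrite cj => jb c; subst b; case: (none _ a c).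
    case: bad => bad; [left; apply: gleI_rejects go bad; rewrite /T; lia | right; apply: gleI_forever go bad].
  left; exists (j :: codeword w); split; [by apply/(good_word_sum _ E); exists j, w | by apply/is_prefix_cons |].
  do 5 eexists; have -> : size (j :: codeword w) = (3 * (size w).+1).+1 by rewrite -size_codeword.
  have -> : (3 * (size w).+1).+1 = 1 + 3 * size w + 3 by lia.
  by apply: gleI_le (gleI_trans go go3) => i; rewrite /T; lia.
case cj : (cc 0) hB pickI => hB pickI.
  exact: (main true f1 o1 (fun i => (f1 i, f2 i)) cj hB d1 erefl pickI).
exact: (main false f2 o2 (fun i => (f1 i, f2 i)) cj hB d2 erefl pickI).
Qed.

End Result.

(** * Accepting paths and resources of the combined machine *)

Section Combined.
Variables (M : bool -> machine) (isprod : bool) (x : seq bool) (k : nat) (sp V : nat).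

Notation BM := (combined M isprod).
Notation good_word := (good_word M isprod x k).

Hypothesis space : forall j c n, cwh (run (M j) x k c n) <= sp /\ cih (run (M j) x k c n) <= sp.
Hypothesis size_S : size x + k < 2 ^ sp.
Hypothesis choices : forall j c n, cch (run (M j) x k c n) <= V.

Lemma good_prefix_inj cc W W' : good_word W -> is_prefix cc W -> good_word W' -> is_prefix cc W' -> W = W'.
Proof.
have [E|E] : isprod \/ ~~ isprod by case: (isprod); [left|right].
  move=> /(@good_word_prod M isprod x k _ E)[w2 [w1 [-> _ _]]] /is_prefix_cat[c2 c1].
  move=> /(@good_word_prod M isprod x k _ E)[w2' [w1' [-> _ _]]] /is_prefix_cat[c2' c1'].
  by have e := coded_inj c2 c2'; subst w2'; rewrite (coded_inj c1 c1').
move=> /(@good_word_sum M isprod x k _ E)[b [w [-> _]]] /is_prefix_cons[cb cw].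
move=> /(@good_word_sum M isprod x k _ E)[b' [w' [-> _]]] /is_prefix_cons[cb' cw'].
by rewrite -cb -cb' (coded_inj cw cw').
Qed.

Lemma behaviour cc Bc (ro : Prop) I :
  (ro -> forall j, read_once (M j)) ->
  (isprod -> (forall n, 0 + 3 * cch (run (M false) x k (vchoice cc 0) n) + 3 <= Bc) /\
     (forall w, acc_path (M false) x k w -> coded cc 0 w ->
       forall n, 0 + 3 * size w + 3 + 3 * cch (run (M true) x k (vchoice cc (0 + 3 * size w + 3)) n) + 3 <= Bc)) ->
  (~~ isprod -> forall n, 1 + 3 * cch (run (M (cc 0)) x k (vchoice cc 1) n) + 3 <= Bc) ->
  (forall i, I = Some i -> forall j base n0, stops x k (run (M j) x k (fun=> false) n0) ->
    (forall m, m < n0 -> ~~ stops x k (run (M j) x k (fun=> false) m)) ->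
    mhalt (cq (run (M j) x k (vchoice cc base) (n0 + i)))) ->
  let T i := 16 * sp + 100 + 16 * i + 8 * Bc in
  exists n0 start, [/\ reach (@step BM x k cc) (@ok M isprod x k cc sp Bc ro) n0 (init BM) start,
    forall m, m <= n0 -> cch (run BM x k cc m) = 0 &
    (exists W, [/\ good_word W, is_prefix cc W &
     exists oc t wh ix ih, @gleI M isprod x k cc sp Bc ro I T start (@cfg M isprod None oc (Acc M) t wh ix ih (size W))]) \/
    (forall W, good_word W -> ~ is_prefix cc W) /\
      (@rejects M isprod x k cc sp Bc ro I T start \/ @runs_forever M isprod x k cc sp Bc ro I start)].
Proof.
move=> once bp bs halting T.
(* The choice bound 0 for the deterministic part also says that the choice head stays on cell 0 up
   to [n0]. *)
have [s [idx [f1 [f2 [o1 [o2 [ls sS ids [d1 d2 [n0 go]]]]]]]]] := @det_part M isprod x k cc sp 0 ro space size_S.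
exists n0; eexists; split.
- by apply: reach_weak go => cf [h1 h2 h3 h4]; split=> //; lia.
- move=> m; rewrite leq_eqVlt => /orP[/eqP->|mn]; first by case: go => e _; rewrite /run e.
  by case: go => _ /(_ m mn)[_ _]; rewrite leqn0 => /eqP.
exact: tail_part.
Qed.

(** [Bc] is taken to be [size W]: on a tape that begins with [W] the simulated machines stay within
    their codewords, and the trace bound then says that no cell behind [W] is read. *)
Lemma good_word_accepted cc W : good_word W -> is_prefix cc W ->
  exists n, [/\ accepting (run BM x k cc n), forall m, m <= n -> cch (run BM x k cc m) <= size W &
            cch (run BM x k cc n) = size W].
Proof.
move=> gW pW.
have [||||n0 [start [go _ res]]] := @behaviour cc (size W) False None => //.
- move=> E; have [w2 [w1 [eW a2 a1]]] := (@good_word_prod M isprod x k _ E).1 gW.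
  move: pW; rewrite eW => /is_prefix_cat[c2 c1]; rewrite size_cat !size_codeword.
  have [_ [_ _ le2]] := coded_accept a2 c2.
  split=> [n|w aw cw n]; first by have := le2 n; lia.
  rewrite -(coded_inj c2 cw); have [_ [_ _ le1]] := coded_accept a1 c1.
  by have := le1 n; lia.
- move=> E; have [b [w [eW a]]] := (@good_word_sum M isprod x k _ E).1 gW.
  move: pW; rewrite eW => /is_prefix_cons[cb cw] n; rewrite cb.
  have [_ [_ _ le]] := coded_accept a cw.
  have -> : size (b :: codeword w) = (3 * (size w).+1).+1 by rewrite -size_codeword.
  by have := le n; lia.
case: res => [[W' [gW' pW' [oc [t [wh [ix [ih [T0 [n _ go']]]]]]]]]|[none _]]; last by case: (none W).
rewrite -(good_prefix_inj gW pW gW' pW') in go'.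
have [e oks] := reach_trans go go'; exists (n0 + n); rewrite /run e; split=> // m.
by rewrite leq_eqVlt => /orP[/eqP->|/oks[]] //; rewrite e.
Qed.

(** A path of at most [V] choices is coded in at most [3 * (V + 1)] cells. Two such paths, or one
    with its tag bit, fit. *)
Let Bc := 6 * V + 8.

Lemma size_acc j w : acc_path (M j) x k w -> size w <= V.
Proof. by move=> [n [_ [_ [m [_ <-]]]]]; apply: choices. Qed.

Lemma general_behaviour cc (ro : Prop) I : (ro -> forall j, read_once (M j)) ->
  (forall i, I = Some i -> forall j c n, 0 < cch (run (M j) x k c n) -> mhalt (cq (run (M j) x k c (n + i.-1)))) ->
  (forall i, I = Some i -> 0 < i) ->
  let T i := 16 * sp + 100 + 16 * i + 8 * Bc in
  exists n0 start, [/\ reach (@step BM x k cc) (@ok M isprod x k cc sp Bc ro) n0 (init BM) start,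
    forall m, m <= n0 -> cch (run BM x k cc m) = 0 &
    (exists W, [/\ good_word W, is_prefix cc W &
     exists oc t wh ix ih, @gleI M isprod x k cc sp Bc ro I T start (@cfg M isprod None oc (Acc M) t wh ix ih (size W))]) \/
    (forall W, good_word W -> ~ is_prefix cc W) /\
      (@rejects M isprod x k cc sp Bc ro I T start \/ @runs_forever M isprod x k cc sp Bc ro I start)].
Proof.
move=> once tail i0; apply: behaviour => //.
- move=> _; split=> [n|w /size_acc wV _ n].
    by have := choices false (vchoice cc 0) n; rewrite /Bc; lia.
  by have := choices true (vchoice cc (0 + 3 * size w + 3)) n; rewrite /Bc; lia.
- by move=> _ n; have := choices (cc 0) (vchoice cc 1) n; rewrite /Bc; lia.
move=> i iI j base n0 st ns.
have rn := vrun_det cc base ns (leqnn n0); have c0 := det_choice0 ns.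
have [h|nh] := boolP (mhalt (cq (run (M j) x k (vchoice cc base) n0))).
  by rewrite (run_halted h) // leq_addr.
(* The step at [n0] is the one that moves the choice head to cell 1, so the tail is counted from
   [n0.+1]. *)
have -> : n0 + i = n0.+1 + i.-1 by have := i0 i iI; lia.
apply: (tail i iI); rewrite runS /step (negbTE nh) rn c0 /=.
move: st; rewrite /stops -rn (negbTE nh) /= rn /wants_choice.
by case: mdelta => [[[[[q a] dw] b] di] []].
Qed.

Lemma halted_reach cc ok n b : reach (@step BM x k cc) ok n (init BM) b -> mhalt (cq b) ->
  forall m, n <= m -> run BM x k cc m = b.
Proof. by move=> [e _] hb m nm; rewrite (run_halted _ nm) /run e. Qed.

(** For the direction to [good_word], the tape is [W] continued by zeros. The run on it is
    deterministic, so if it accepts, it accepts a good word [W'] with which the tape begins. Both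
    [W] and [W'] have the length of the largest choice cell visited, hence they are equal. *)
Lemma acc_pathP W : acc_path BM x k W <-> good_word W.
Proof.
split=> [|gW]; last first.
  have [n [h1 h2 h3]] := good_word_accepted (cc := fun i => nth false W i) gW (fun i _ => erefl).
  by exists n; split=> //; split=> //; exists n.
set cc := fun i => nth false W i; move=> [n [an [bn [m [mn em]]]]]; rewrite -/cc in an bn em.
have [hn _] := andP an.
have [|||n0 [start [go _ res]]] := @general_behaviour cc False None => //.
case: res => [[W' [gW' pW' _]]|[_ [rej|[_ /(_ n)[t [b nt [go' nb]]]]]]]; last first.
- case/negP: nb; have [<- _] := reach_trans go go'; rewrite -/(run BM x k cc (n0 + t)) (run_halted hn) //.
  by lia.
- have [oc [t [wh [ix [ih [ch [T0 [n' _ go']]]]]]]] := rej.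
  have := halted_reach (reach_trans go go') isT (leq_maxl (n0 + n') n).
  by rewrite (run_halted hn) ?leq_maxr // => e; move: an; rewrite e.
have [n' [an' bn' en']] := good_word_accepted gW' pW'.
have [hn' _] := andP an'.
have s1 : size W <= size W'.
  rewrite -em; case: (leqP m n') => mn'; first exact: bn'.
  by rewrite (run_halted hn') ?en' // ltnW.
have s2 : size W' <= size W.
  rewrite -en'; case: (leqP n' n) => nn'; first exact: bn.
  by rewrite (run_halted hn) ?bn // ltnW.
have -> : W = W'; last by [].
apply: (@eq_from_nth _ false) => [|i iW]; first by lia.
by apply: pW'; lia.
Qed.

Lemma combined_num_acc N1 N2 : num_acc (M true) x k N1 -> num_acc (M false) x k N2 ->
  num_acc BM x k (if isprod then N1 * N2 else N1 + N2).
Proof.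
move=> [s1 [u1 [h1 <-]]] [s2 [u2 [h2 <-]]].
have cwP w : coded (fun i => nth false (codeword w) i) 0 w.
  by move=> i iw; rewrite add0n nth_codeword.
have cinj : injective codeword.
  by move=> w w' e; apply: coded_inj (cwP w) _; rewrite e.
have [E|E] : isprod \/ ~~ isprod by case: (isprod); [left|right].
  exists [seq codeword w2 ++ codeword w1 | w2 <- s2, w1 <- s1]; rewrite ifT // mulnC size_allpairs.
  split; [|split=> //].
    apply: allpairs_uniq => // -[w2 w1] [w2' w1'] _ _.
    rewrite -[LHS]/(codeword w2 ++ codeword w1) -[RHS]/(codeword w2' ++ codeword w1') => e.
    have /is_prefix_cat[c2 c1] : is_prefix (fun i => nth false (codeword w2 ++ codeword w1) i) (codeword w2 ++ codeword w1) by [].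
    have /is_prefix_cat[c2' c1'] : is_prefix (fun i => nth false (codeword w2 ++ codeword w1) i) (codeword w2' ++ codeword w1') by rewrite e.
    by have e2 := coded_inj c2 c2'; subst w2'; rewrite (coded_inj c1 c1').
  move=> W; rewrite acc_pathP (@good_word_prod M isprod x k _ E); split.
    by case/allpairsP => -[w2 w1] [/h2 a2 /h1 a1 ->]; exists w2, w1.
  move=> [w2 [w1 [-> a2 a1]]]; apply/allpairsP; exists (w2, w1); split=> //; [exact/h2|exact/h1].
have consinj b : injective (fun w => b :: codeword w).
  by move=> w w' /(congr1 behead); apply: cinj.
exists ([seq true :: codeword w | w <- s1] ++ [seq false :: codeword w | w <- s2]).
rewrite ifN // size_cat !size_map; split; [|split=> //].
  rewrite cat_uniq (map_inj_uniq (consinj true)) (map_inj_uniq (consinj false)) u1 u2 andbT andTb.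
  by apply/hasPn => _ /mapP[w _ ->]; apply/mapP => -[].
move=> W; rewrite acc_pathP (@good_word_sum M isprod x k _ E) mem_cat; split.
  by case/orP => /mapP[w ws ->]; [exists true, w; split=> //; apply/h1 | exists false, w; split=> //; apply/h2].
by move=> [[] [w [-> a]]]; apply/orP; [left|right]; apply/mapP; exists w => //; [apply/h1|apply/h2].
Qed.

(** All configurations of a trace but its last satisfy [ok]; the halting one is a single step
    further, hence [sp + 5] and [Bc.+1]. *)
Lemma combined_safe cc (ro : Prop) n : (ro -> forall j, read_once (M j)) ->
  let cf := run BM x k cc n in
  [/\ cwh cf <= sp + 5, cih cf <= sp + 5, cch cf <= Bc.+1 & ro -> cch cf <= cch (run BM x k cc n.+1)].
Proof.
move=> once.
pose okk := @ok M isprod x k cc sp Bc ro.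
have weaken m : okk (run BM x k cc m) -> let cf := run BM x k cc m in
  [/\ cwh cf <= sp + 5, cih cf <= sp + 5, cch cf <= Bc.+1 & ro -> cch cf <= cch (run BM x k cc m.+1)].
  by move=> [h1 h2 h3 h4]; split=> //; lia.
have halted m b : reach (@step BM x k cc) okk m (init BM) b -> mhalt (cq b) ->
  let cf := run BM x k cc n in
  [/\ cwh cf <= sp + 5, cih cf <= sp + 5, cch cf <= Bc.+1 & ro -> cch cf <= cch (run BM x k cc n.+1)].
  move=> rb hb; have [e oks] := rb; case: (ltnP n m) => nm; first exact/weaken/oks.
  rewrite (halted_reach rb hb) // (halted_reach rb hb) ?leqW //.
  case: m e oks {rb nm} => [<- _|m <- oks]; first by split.
  have [h1 h2 h3 _] := oks m (leqnn _); rewrite iterS.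
  have [l1 l2 l3] := step_le x k cc (iter m (@step BM x k cc) (init BM)).
  by split=> //; lia.
have [||n0 [start [go _ res]]] := @general_behaviour cc ro None once => //.
case: res => [[W' [_ _ [oc [t [wh [ix [ih [T0 [n' _ go']]]]]]]]]|[_ [rej|[_ /(_ n)[t [b nt [go' nb]]]]]]].
- exact: halted (reach_trans go go') isT.
- have [oc [t [wh [ix [ih [ch [T0 [n' _ go']]]]]]]] := rej.
  exact: halted (reach_trans go go') isT.
have [e oks] := reach_trans go go'.
by apply/weaken/oks; lia.
Qed.

Lemma combined_tail G :
  (forall j c n, 0 < cch (run (M j) x k c n) -> mhalt (cq (run (M j) x k c (n + G)))) ->
  forall cc n, 0 < cch (run BM x k cc n) ->
    mhalt (cq (run BM x k cc (n + (16 * sp + 100 + 16 * G.+1 + 8 * Bc)))).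
Proof.
move=> tail cc n cn.
(* [G.+1] counts the first nondeterministic simulated step and the [G] steps after it. Time is
   measured from [start], where the choice head is still on cell 0, so [n0 <= n] is enough below. *)
have [|||n0 [start [go c0 res]]] := @general_behaviour cc False (Some G.+1) => //.
- by move=> i [<-].
- by move=> i [<-].
have nn : n0 <= n.
  by rewrite leqNgt; apply/negP => /ltnW/c0 e; rewrite e in cn.
move: res; set T := fun i : nat => _ => res.
have [K KE] : exists K, K = 16 * sp + 100 + 16 * G.+1 + 8 * Bc by eexists.
rewrite -KE.
have fin b : mhalt (cq b) -> @gleI M isprod x k cc sp Bc False (Some G.+1) T start b ->
    mhalt (cq (run BM x k cc (n + K))).
  move=> hb [n' n'le go']; rewrite -[T _]KE in n'le.
  by rewrite (halted_reach (reach_trans go go') hb) // leq_add.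
clear KE; case: res => [[W' [_ _ [oc [t [wh [ix [ih go']]]]]]]|[_ [rej|[nI _]]]]; first exact: fin go'.
  by have [oc [t [wh [ix [ih [ch go']]]]]] := rej; apply: fin go'.
by [].
Qed.

End Combined.

(** * Bounds for the four classes *)

Definition both (M1 M2 : machine) (j : bool) := if j then M1 else M2.

Lemma lg_gt0 n : 0 < lg n. Proof. by []. Qed.

Section Classes.
Variables (M1 M2 : machine) (cs1 cs2 : nat) (f1 f2 b1 b2 : nat -> nat).
Hypotheses (sp1 : para_L_space M1 cs1 f1) (sp2 : para_L_space M2 cs2 f2).
Hypotheses (kb1 : k_bounded M1 b1) (kb2 : k_bounded M2 b2).

(** The summands [lg (size x) + k] are there for the region marked at the beginning, which asks for
    [size x + k < 2 ^ sp]. *)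
Let space_bound (x : seq bool) k := cs1 * (lg (size x) + f1 k) + cs2 * (lg (size x) + f2 k) + lg (size x) + k.
Let choice_bound (x : seq bool) k := (b1 k + b2 k) * lg (size x).

Lemma both_space x k j c n : cwh (run (both M1 M2 j) x k c n) <= space_bound x k /\
  cih (run (both M1 M2 j) x k c n) <= space_bound x k.
Proof.
by case: j; [have [] := sp1 x k c n | have [] := sp2 x k c n]; rewrite /space_bound /both => h1 h2; split;
  [apply: leq_trans h1 _ | apply: leq_trans h2 _ | apply: leq_trans h1 _ | apply: leq_trans h2 _]; rewrite -!addnA ?leq_addr // addnCA leq_addr.
Qed.

Lemma size_space_bound x k : size x + k < 2 ^ space_bound x k.
Proof.
apply: (@leq_trans (2 ^ (lg (size x) + k))); last by rewrite leq_exp2l // /space_bound -!addnA; lia.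
have h1 : size x < 2 ^ lg (size x) by apply: trunc_log_ltn.
have h2 : k < 2 ^ k by apply: ltn_expl.
by rewrite expnD; nia.
Qed.

Lemma both_choices x k j c n : cch (run (both M1 M2 j) x k c n) <= choice_bound x k.
Proof.
rewrite /choice_bound mulnDl.
by case: j; [have := kb1 x k c n | have := kb2 x k c n]; rewrite /both => h; apply: leq_trans h _;
  rewrite ?leq_addr ?leq_addl.
Qed.

Hypotheses (df : dominated (fun k => f1 k + f2 k)) (db : dominated (fun k => b1 k + b2 k)).

Lemma combined_base isprod F1 F2 :
  (forall x k, num_acc M1 x k (F1 x k)) -> (forall x k, num_acc M2 x k (F2 x k)) ->
  base_para (combined (both M1 M2) isprod) (fun x k => if isprod then F1 x k * F2 x k else F1 x k + F2 x k).
Proof.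
move=> n1 n2; split; [|split].
- have [h ch hle] := dominated_add df (dominated_computable computable_id).
  (* Besides [cs1 + cs2], one unit covers the summand [lg (size x)] and five the slack of
     [combined_safe]; [h] dominates [f1 k + f2 k + k]. *)
  exists (cs1 + cs2 + 6), h; split=> // x k c n.
  have [h1 h2 _ _] := @combined_safe _ isprod x k _ _ (both_space x k) (size_space_bound x k) (both_choices x k) c False n (fun e => match e with end).
  have le : space_bound x k + 5 <= (cs1 + cs2 + 6) * (lg (size x) + h k).
    rewrite /space_bound; have := hle k; have := lg_gt0 (size x); move: (lg _) (h k) => l hk l0 /= hh.
    have e1 : cs1 * (l + f1 k) <= cs1 * (l + hk) by rewrite leq_mul2l; apply/orP; right; lia.
    have e2 : cs2 * (l + f2 k) <= cs2 * (l + hk) by rewrite leq_mul2l; apply/orP; right; lia.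
    by rewrite !mulnDl; lia.
  by split; [apply: leq_trans h1 le | apply: leq_trans h2 le].
- have [h ch hle] := dominated_add (dominated_mul 6 db) (dominated_const 9).
  exists h; split=> // x k c n.
  have [_ _ h1 _] := @combined_safe _ isprod x k _ _ (both_space x k) (size_space_bound x k) (both_choices x k) c False n (fun e => match e with end).
  apply: leq_trans h1 _; rewrite /choice_bound.
  apply: leq_trans (_ : (6 * (b1 k + b2 k) + 9) * lg (size x) <= _); last by rewrite leq_mul2r hle orbT.
  have := lg_gt0 (size x); move: (b1 k + b2 k) (lg (size x)) => b l l0.
  by rewrite mulnDl mulnA; lia.
move=> x k; have := @combined_num_acc (both M1 M2) isprod x k _ _ (both_space x k) (size_space_bound x k) (both_choices x k) _ _ (n1 x k) (n2 x k); exact.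
Qed.

Lemma combined_read_once isprod : read_once M1 -> read_once M2 -> read_once (combined (both M1 M2) isprod).
Proof.
move=> r1 r2 x k c n; have r : True -> forall j, read_once (both M1 M2 j) by move=> _ [].
by have [_ _ _] := @combined_safe _ isprod x k _ _ (both_space x k) (size_space_bound x k) (both_choices x k) c True n r; apply.
Qed.

Lemma tail_both g1 g2 : tail_nondet M1 g1 -> tail_nondet M2 g2 ->
  forall x k j c n, 0 < cch (run (both M1 M2 j) x k c n) ->
    mhalt (cq (run (both M1 M2 j) x k c (n + (g1 k + g2 k) * lg (size x)))).
Proof.
move=> t1 t2 x k j c n; rewrite mulnDl.
case: j => /= h; [have hh := t1 x k c n h | have hh := t2 x k c n h];
  by rewrite (run_halted hh) // leq_add2l ?leq_addr ?leq_addl.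
Qed.

Lemma combined_tail_nondet isprod g1 g2 : tail_nondet M1 g1 -> tail_nondet M2 g2 ->
  dominated (fun k => g1 k + g2 k) ->
  exists g, computable g /\ tail_nondet (combined (both M1 M2) isprod) g.
Proof.
move=> t1 t2 dg.
have d1 := dominated_mul (16 * (cs1 + cs2)) df.
have d2 := dominated_mul 16 dg.
have d3 := dominated_mul 48 db.
have d4 := dominated_mul 16 (dominated_computable computable_id).
(* The additive constants of the time bound sum to 100 + 16 + 64, and the summand [lg (size x)] of
   the space bound contributes another 16; 200 rounds this up. The factor 48 above is 8 times the 6
   in [Bc]. *)
have d5 := dominated_const (16 * (cs1 + cs2) + 200).
have [g cg hle] := dominated_add d1 (dominated_add d2 (dominated_add d3 (dominated_add d4 d5))).
exists g; split=> // x k c n cn.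
have := @combined_tail _ isprod x k _ _ (both_space x k) (size_space_bound x k) (both_choices x k) _ (tail_both t1 t2 (x := x) (k := k)) c n cn.
set T := (X in n + X) => hT; apply: (fun le => eq_ind_r (fun r => mhalt (cq r)) hT (run_halted hT le)).
rewrite leq_add2l; apply: leq_trans (leq_mul (hle k) (leqnn (lg (size x)))).
rewrite /T /space_bound /choice_bound.
have := lg_gt0 (size x); move: (lg _) => l l0 /=.
move: (f1 k) (f2 k) (b1 k) (b2 k) (g1 k) (g2 k) => x1 x2 y1 y2 z1 z2.
have e1 : cs1 * (l + x1) <= cs1 * (1 + x1) * l by nia.
have e2 : cs2 * (l + x2) <= cs2 * (1 + x2) * l by nia.
have e3 : k <= k * l by nia.
nia.
Qed.

End Classes.

Theorem theorem12 : forall (C : para_class) (F1 F2 : seq bool -> nat -> nat),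
  in_class C F1 -> in_class C F2 ->
  in_class C (fun x k => F1 x k + F2 x k) /\
  in_class C (fun x k => F1 x k * F2 x k).
Proof.
move=> C F1 F2.
have dom f g : computable f -> computable g -> dominated (fun k => f k + g k).
  by move=> cf cg; apply: dominated_add; apply: dominated_computable.
have main M1 M2 isprod : base_para M1 F1 -> base_para M2 F2 ->
  let BM := combined (both M1 M2) isprod in
  [/\ base_para BM (fun x k => if isprod then F1 x k * F2 x k else F1 x k + F2 x k),
   read_once M1 -> read_once M2 -> read_once BM &
   (exists g, computable g /\ tail_nondet M1 g) -> (exists g, computable g /\ tail_nondet M2 g) ->
   exists g, computable g /\ tail_nondet BM g].
  move=> [[cs1 [f1 [cf1 sp1]]] [[b1 [cb1 kb1]] n1]] [[cs2 [f2 [cf2 sp2]]] [[b2 [cb2 kb2]] n2]] BM.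
  have df := dom _ _ cf1 cf2; have db := dom _ _ cb1 cb2; split.
  - exact: (combined_base sp1 sp2 kb1 kb2 df db isprod n1 n2).
  - exact: (combined_read_once sp1 sp2 kb1 kb2).
  move=> [g1 [cg1 t1]] [g2 [cg2 t2]].
  exact: (combined_tail_nondet sp1 sp2 kb1 kb2 df db isprod t1 t2 (dom _ _ cg1 cg2)).
case: C => /=.
- move=> [M1 B1] [M2 B2]; split.
    by exists (combined (both M1 M2) false); have [] := main M1 M2 false B1 B2.
  by exists (combined (both M1 M2) true); have [] := main M1 M2 true B1 B2.
- move=> [M1 [B1 t1]] [M2 [B2 t2]]; split.
    by exists (combined (both M1 M2) false); have [b _ t] := main M1 M2 false B1 B2; split=> //; apply: t.
  by exists (combined (both M1 M2) true); have [b _ t] := main M1 M2 true B1 B2; split=> //; apply: t.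
- move=> [M1 [B1 r1]] [M2 [B2 r2]]; split.
    by exists (combined (both M1 M2) false); have [b r _] := main M1 M2 false B1 B2; split=> //; apply: r.
  by exists (combined (both M1 M2) true); have [b r _] := main M1 M2 true B1 B2; split=> //; apply: r.
move=> [M1 [B1 [r1 t1]]] [M2 [B2 [r2 t2]]]; split.
  exists (combined (both M1 M2) false); have [b r t] := main M1 M2 false B1 B2.
  by split=> //; split; [apply: r | apply: t].
exists (combined (both M1 M2) true); have [b r t] := main M1 M2 true B1 B2.
by split=> //; split; [apply: r | apply: t].
Qed.
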